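(* Let $\{Q_n\}_{n\in\mathbb{N}}$ be a sequence of polynomials with $\deg Q_n=n$, all of whose zeros belong to the interval $[-1,1]\subset\mathbb{R}$, and such that the sequence of probability zero-counting measures $$\sigma_{n,0}=\frac1n\sum_{Q_n(x)=0}\delta_x$$ converges in the weak-* topology, as $n\to\infty$, to the arcsine distribution $\mu_0$, $$d\mu_0(x)=\frac{dx}{\pi\sqrt{1-x^2}},\qquad x\in(-1,1).$$ For $0\le k\le n-1$ let $$\sigma_{n,k}=\frac1n\sum_{Q_{n,k}(x)=0}\delta_x,\qquad Q_{n,k}(x)=\frac{(n-k)!}{n!}\,\frac{d^k}{dx^k}Q_n(x).$$ Then for any $t\in[0,1)$ and any sequence $k_n$ of natural numbers with $k_n/n\to t$, the sequence $\sigma_{n,k_n}$ has a weak-* limit $\mu_t$ as $n\to\infty$, where $\mu_t$ is absolutely continuous and $$d\mu_t(x)=\frac1\pi\,\frac{\sqrt{1-t^2-x^2}}{1-x^2}\,dx,\qquad x\in\left[-\sqrt{1-t^2},\sqrt{1-t^2}\right].$$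
   Context: In all zero-counting measures, the sum runs over the zeros counted with multiplicity, and $\delta_x$ is the unit point mass at $x$; thus $\sigma_{n,k}$ has total mass $(n-k)/n$ and is supported on $[-1,1]$. The measure $\sigma_{n,k_n}$ is defined when $0\le k_n\le n-1$, which holds for all sufficiently large $n$ since $k_n/n\to t<1$. Weak-* convergence of finite Borel measures on $[-1,1]$ means convergence of integrals against every continuous function on $[-1,1]$. The measure $\mu_t$ is supported on $[-\sqrt{1-t^2},\sqrt{1-t^2}]$ (it is zero outside this interval). *)

(* Defs.v *)
From HB Require Import structures.
From mathcomp Require Import all_boot all_order all_algebra.
From mathcomp Require Import all_classical all_reals all_analysis.
From mathcomp Require Import measurable_realfun.
From mathcomp.real_closed Require Import complex.

Set Implicit Arguments.
Unset Strict Implicit.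
Unset Printing Implicit Defensive.

Import Order.TTheory GRing.Theory Num.Theory.
Import numFieldNormedType.Exports.

Local Open Scope classical_set_scope.
Local Open Scope ring_scope.

Section ZeroCounting.
Variable R : realType.
Implicit Types (p : {poly R[i]}) (Q : nat -> {poly R[i]}).

(* The complex zeros of p, repeated according to multiplicity, in an
   unspecified order; only meaningful for p != 0. *)
Definition zeros p : seq R[i] := sval (closed_field_poly_normal p).

(* The sum of the unit masses at the zeros of p, divided by n, as a Borel
   measure on the real line.  It is applied to polynomials whose zeros are all
   real, for which complex.Re just identifies a zero with a point of R. *)
Definition zero_counting (n : nat) p :
    {measure set (measurableTypeR R) -> \bar R} :=
  mscale (n%:R^-1)%:nng
    (msum (fun i => \d_((complex.Re (zeros p)`_i : measurableTypeR R)))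
          (size (zeros p))).

Definition normalized_derivative Q (n k : nat) : {poly R[i]} :=
  ((n - k)`!%:R / n`!%:R) *: (Q n)^`(k).

(* Meaningful for k <= n.-1 only. *)
Definition sigma Q (n k : nat) := zero_counting n (normalized_derivative Q n k).

End ZeroCounting.

(* Weak-* convergence of finite Borel measures on [-1, 1], a measure on
   [-1, 1] being given as a measure on R carried by [-1, 1]. *)
Definition weak_star_cvg (R : realType)
    (m : nat -> {measure set (measurableTypeR R) -> \bar R})
    (mu : {measure set (measurableTypeR R) -> \bar R}) : Prop :=
  forall f : R -> R, {within `[-1, 1], continuous f} ->
    \int[m n]_(x in `[-1, 1]) f x @[n --> \oo] --> \int[mu]_(x in `[-1, 1]) f x.

Section DensityMeasure.
Variables (R : realType) (f : R -> R).

Definition density_measure (f0 : forall x, 0 <= f x)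
    (mf : measurable_fun setT f) : set (measurableTypeR R) -> \bar R :=
  fun A => (\int[lebesgue_measure]_(x in A) (f x)%:E)%E.

Hypotheses (f0 : forall x, 0 <= f x) (mf : measurable_fun setT f).

Let density_measure0 : density_measure f0 mf set0 = 0%E.
Proof. by rewrite /density_measure integral_set0. Qed.

Let density_measure_ge0 A : (0 <= density_measure f0 mf A)%E.
Proof. by apply: integral_ge0 => x _; rewrite lee_fin. Qed.

Let density_measure_sigma_additive : semi_sigma_additive (density_measure f0 mf).
Proof.
apply: semi_sigma_additive_nng_induced => [|x]; last by rewrite lee_fin.
exact/measurable_EFinP.
Qed.

HB.instance Definition _ := isMeasure.Build _ _ _ (density_measure f0 mf)
  density_measure0 density_measure_ge0 density_measure_sigma_additive.

End DensityMeasure.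

Section LimitMeasures.
Variable R : realType.

Definition arcsine_density : R -> R :=
  (fun x => (pi * Num.sqrt (1 - x ^+ 2))^-1) \_ `]-1, 1[.

Definition mu_density (t : R) : R -> R :=
  (fun x => pi^-1 * (Num.sqrt (1 - t ^+ 2 - x ^+ 2) / (1 - x ^+ 2)))
  \_ `[- Num.sqrt (1 - t ^+ 2), Num.sqrt (1 - t ^+ 2)].

Lemma arcsine_density_ge0 x : 0 <= arcsine_density x.
Proof.
rewrite /arcsine_density patchE; case: ifP => // _.
by rewrite invr_ge0 mulr_ge0 ?pi_ge0 ?sqrtr_ge0.
Qed.

Let sqr_le1_of_mem (t x : R) :
  x \in `[- Num.sqrt (1 - t ^+ 2), Num.sqrt (1 - t ^+ 2)] -> 0 <= 1 - x ^+ 2.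
Proof.
rewrite in_itv /= -ler_norml subr_ge0 => xs.
rewrite -real_normK ?num_real// expr_le1//; apply: le_trans xs _.
by rewrite -[leRHS]sqrtr1 ler_wsqrtr// gerBl sqr_ge0.
Qed.

Lemma mu_density_ge0 t x : 0 <= mu_density t x.
Proof.
rewrite /mu_density patchE; case: ifP => // /set_mem /sqr_le1_of_mem x1.
by rewrite mulr_ge0 ?invr_ge0 ?pi_ge0// divr_ge0 ?sqrtr_ge0.
Qed.

Let measurable_sqrt : measurable_fun setT (@Num.sqrt R).
Proof. exact: continuous_measurable_fun (@sqrt_continuous R). Qed.

Let measurable_inv (D : set R) (g : R -> R) :
  measurable_fun D g -> {in D, forall x, 0 <= g x} ->
  measurable_fun D (fun x => (g x)^-1).
Proof.
move=> mg g0; apply: (eq_measurable_fun (fun x => g x `^ (- 1))).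
  by move=> x Dx; rewrite powR_inv1// g0.
exact: measurableT_comp (measurable_powR _) mg.
Qed.

Lemma measurable_arcsine_density : measurable_fun setT arcsine_density.
Proof.
apply/(measurable_restrictT _ _).1 => //; apply: measurable_inv => [|x _].
  apply: measurable_funTS; apply: measurable_funM => //.
  by apply: measurableT_comp => //; apply: measurable_funB.
by rewrite mulr_ge0 ?pi_ge0 ?sqrtr_ge0.
Qed.

Lemma measurable_mu_density t : measurable_fun setT (mu_density t).
Proof.
apply/(measurable_restrictT _ _).1 => //; apply: measurable_funM => //.
apply: measurable_funM.
  apply: measurable_funTS; apply: measurableT_comp => //.
  exact: measurable_funB.
apply: measurable_inv => [|x].
  by apply: measurable_funTS; apply: measurable_funB.
by move/set_mem; exact: sqr_le1_of_mem.
Qed.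

Definition arcsine_measure : {measure set (measurableTypeR R) -> \bar R} :=
  density_measure arcsine_density_ge0 measurable_arcsine_density.

Definition mu_measure (t : R) : {measure set (measurableTypeR R) -> \bar R} :=
  density_measure (mu_density_ge0 t) (measurable_mu_density t).

End LimitMeasures.

(* Main.v *)
Require Import Defs.
From HB Require Import structures.
From mathcomp Require Import all_boot all_order all_algebra.
From mathcomp Require Import all_classical all_reals all_analysis.
From mathcomp Require Import measurable_realfun.
From mathcomp.real_closed Require Import complex.
From mathcomp Require Import ring lra.
From mathcomp Require Import zify.

Set Implicit Arguments.
Unset Strict Implicit.
Unset Printing Implicit Defensive.

Import Order.TTheory GRing.Theory Num.Theory.
Import numFieldNormedType.Exports.

Local Open Scope classical_set_scope.
Local Open Scope ring_scope.

(** Why the theorem holds.  All measures live on [-1, 1], so by the theorem of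
    Weierstrass it suffices to prove convergence of moments (lemmas [weierstrass]
    and [moments_weak_cvg]).  Let [P] be a real-rooted polynomial of degree [n], and
    let [h k c] be the [c]-th power sum of the zeros of its [k]-th derivative,
    divided by [n]; these zeros stay in [-1, 1] by a Gauss-Lucas argument.

    Let [p] and [q] be the generating series, in [y = 1 / x], of the power sums of
    the zeros of [P^`(k)] and [P^`(k.+1)].  They are the expansions at infinity of
    [x] times the logarithmic derivatives of these two polynomials, and their
    difference is [x] times the derivative of the logarithm of
    [P^`(k.+1) / P^`(k)]; this gives the exact identity [p (q - p) = - p - y p'] ([power_sums_deriv]).
    Read coefficientwise, it says that differentiating once is one Euler step of
    length [1 / n] for a fixed triangular system of ordinary differential equations
    in the moments ([deriv_euler_scheme]).  The step is a contraction in the moment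
    of highest order, so two solutions whose initial moments are close remain close,
    uniformly in [n], as long as [n - k] is at least a fixed fraction of [n]
    ([euler_stability]).  Hence the limit of the moments after [k_n] steps depends
    only on [t] and on the limit of the initial moments.

    It is therefore enough to know the answer for one sequence of polynomials, and
    the Chebyshev polynomials do it.  Their derivatives satisfy a linear
    differential equation of order two, that is, a Riccati equation for [p], which
    in the limit becomes the quadratic equation
    [(1 - y ^ 2) m ^ 2 + 2 t m = 1 - t ^ 2] ([chebyshev_riccati], [riccati_cvg]).
    The recursion on the coefficients of [m] determines them from [m_0 = 1 - t].

    It remains to see that the moments of [mu_t] solve the same equation.
    Multiplying the density by [1 - x ^ 2] leaves a semicircle, so two moments of
    [mu_t] of orders [c] and [c + 2] differ by a moment of the semicircle, and these
    obey a two-term recursion.  With the total mass [1 - t] this shows that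
    [w = (1 - y ^ 2) m + t] satisfies [(1 - r y ^ 2) w' = - r y w] with
    [r = 1 - t ^ 2], hence [w ^ 2 = 1 - r y ^ 2], which is the quadratic equation
    ([limit_moments_of_recursion], [mu_measure_moments]).  For [t = 0] these are the
    moments of the arcsine law, so the two initial limits agree as well. *)

(** * Uniform approximation by polynomials *)

Section Bernstein.
Variable R : realType.
Implicit Types (f : R -> R) (g : nat -> R).

(** The expectation of [g] under the binomial law with parameters [n] and ['X],
    built one trial at a time so that its moments follow by induction. *)
Fixpoint bernstein n g : {poly R} :=
  if n is m.+1 then (1 - 'X) * bernstein m g + 'X * bernstein m (g \o S)
  else (g 0)%:P.

Lemma bernsteinB n g1 g2 x :
  (bernstein n (g1 \- g2)).[x] = (bernstein n g1).[x] - (bernstein n g2).[x].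
Proof.
elim: n g1 g2 => [|n IH] g1 g2 /=; first by rewrite !hornerC.
rewrite !hornerE IH.
have -> : (g1 \- g2) \o S = (g1 \o S) \- (g2 \o S) by [].
by rewrite IH; ring.
Qed.

Lemma bernstein_cst n c x : (bernstein n (fun=> c)).[x] = c.
Proof.
elim: n => [|n IH] /=; first by rewrite hornerC.
have -> : (fun=> c) \o S = (fun=> c) :> (nat -> R) by [].
by rewrite !hornerE IH; ring.
Qed.

Lemma bernstein_affine n a b g x :
  (bernstein n (fun k => a + b * g k)).[x] = a + b * (bernstein n g).[x].
Proof.
elim: n g => [|n IH] g /=; first by rewrite !hornerC.
rewrite !hornerE IH.
have -> : (fun k => a + b * g k) \o S = (fun k => a + b * (g \o S) k) by [].
by rewrite IH; ring.
Qed.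

Lemma le_bernstein n g1 g2 x : 0 <= x <= 1 ->
  (forall k, (k <= n)%N -> g1 k <= g2 k) ->
  (bernstein n g1).[x] <= (bernstein n g2).[x].
Proof.
move=> /andP[x0 x1]; elim: n g1 g2 => [|n IH] g1 g2 le12 /=.
  by rewrite !hornerC le12.
rewrite !hornerE lerD// ler_wpM2l ?subr_ge0// IH// => k kn; apply: le12 => //.
exact: leqW.
Qed.

(** The centre is arbitrary so that the induction can shift it at each trial. *)
Lemma bernstein_sqr n c x :
  (bernstein n (fun k => (k%:R - c) ^+ 2)).[x] =
  n%:R * (x * (1 - x)) + (n%:R * x - c) ^+ 2.
Proof.
elim: n c => [|n IH] c /=; first by rewrite hornerC; ring.
have -> : (fun k => (k%:R - c) ^+ 2) \o S = (fun k => (k%:R - (c - 1)) ^+ 2).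
  by apply/funext => k /=; rewrite -natr1; ring.
by rewrite !(hornerD, hornerM, hornerN, hornerX, hornerC) !IH -natr1; ring.
Qed.

Lemma segment_uniform_continuous (a b : R) f :
  {within `[a, b], continuous f} ->
  forall e : R, 0 < e -> exists2 d : R, 0 < d &
    forall x y : R, x \in `[a, b] -> y \in `[a, b] -> `|x - y| < d ->
    `|f x - f y| < e.
Proof.
move=> /subspace_continuousP fc e e0.
have /compact_near_coveringP K := @segment_compact R a b.
pose P (d : R) (x : R) := forall y, y \in `[a, b] -> `|x - y| < d ->
   x \in `[a, b] -> `|f x - f y| < e.
have e20 : 0 < e / 2 by rewrite divr_gt0.
have [x xab|] := @K R 0^'+ P _.
  have /cvgrPdist_lt/(_ _ e20) := fc _ xab.
  rewrite near_withinE => -[/= d d0 xd].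
  exists (ball x (d / 2), [set r | r < d / 2]) => /=.
    split; first by apply: nbhsx_ballx; exact: divr_gt0.
    exact: nbhs_right_lt (divr_gt0 _ _).
  move=> [z r] [/= xz rd] y yab zy zab.
  have xy : ball x d y.
    rewrite /ball/=; rewrite /ball/= in xz.
    rewrite -[x](subrK z) -addrA (le_lt_trans (ler_normD _ _))//.
    by rewrite [d]splitr ltrD// (lt_trans zy).
  have xz' : ball x d z.
    by apply: (le_ball _ xz); lra.
  rewrite -[f z](subrK (f x)) -addrA (le_lt_trans (ler_normD _ _))//.
  by rewrite [e]splitr ltrD ?(distrC (f z))//; [apply: (xd z)|apply: (xd y)].
move=> d /= d0 Kd; exists (d / 2); first exact: divr_gt0.
move=> x y xab yab xy.
apply: (Kd (d / 2)) => //=; last exact: divr_gt0.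
by rewrite sub0r normrN gtr0_norm ?divr_gt0//; lra.
Qed.

Lemma segment_bounded (a b : R) f :
  {within `[a, b], continuous f} ->
  exists2 M : R, 0 < M & forall x : R, x \in `[a, b] -> `|f x| <= M.
Proof.
move=> fc; have := continuous_compact fc (@segment_compact R a b).
move=> /compact_bounded[M [_ HM]]; exists (`|M| + 1).
  by rewrite ltr_wpDl.
move=> x xab; apply: (HM (`|M| + 1)); last by exists x.
by rewrite (le_lt_trans (ler_norm _)) ?ltrDl.
Qed.

End Bernstein.

Section Weierstrass.
Variable R : realType.
Implicit Types f : R -> R.

Let weierstrass01 f : {within `[0, 1], continuous f} ->
  forall e : R, 0 < e -> exists p : {poly R},
    forall x : R, x \in `[0, 1] -> `|f x - p.[x]| <= e.
Proof.
move=> fc e e0.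
have [M M0 fM] := segment_bounded fc.
have e20 : 0 < e / 2 by rewrite divr_gt0.
have [d d0 fd] := segment_uniform_continuous fc e20.
pose C := 2 * M / d ^+ 2.
have C0 : 0 <= C by rewrite divr_ge0 ?sqr_ge0 ?mulr_ge0 ?ltW.
(* Points far from [x] are absorbed by the second moment. *)
have osc (x y : R) : x \in `[0, 1] -> y \in `[0, 1] ->
    `|f x - f y| <= e / 2 + C * (x - y) ^+ 2.
  move=> x01 y01; have [xy|xy] := ltP `|x - y| d.
    by rewrite (le_trans (ltW (fd _ _ x01 y01 xy)))// lerDl mulr_ge0 ?sqr_ge0.
  rewrite (@le_trans _ _ (2 * M))//.
    by rewrite (le_trans (ler_normB _ _))// mulr_natl mulr2n lerD// fM.
  have -> : C * (x - y) ^+ 2 = 2 * M * (x - y) ^+ 2 / d ^+ 2.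
    by rewrite /C mulrAC.
  rewrite (@le_trans _ _ (2 * M * (x - y) ^+ 2 / d ^+ 2)) //; last by rewrite lerDr ltW.
  rewrite ler_pdivlMr ?exprn_gt0// ler_pM2l ?mulr_gt0//.
  rewrite -[leRHS]real_normK ?num_real//.
  by rewrite lerXn2r ?nnegrE// ltW.
have [n n0 nC] : exists2 n, (0 < n)%N & C / n%:R <= e / 2.
  exists (Num.truncn (C / (e / 2))).+1 => //.
  rewrite ler_pdivrMr ?ltr0n// mulrC -ler_pdivrMr//.
  by rewrite ltW// truncnS_gt.
have nR : 0 < n%:R :> R by rewrite ltr0n.
exists (bernstein n (fun k => f (k%:R / n%:R))) => x x01.
have kn01 k : (k <= n)%N -> k%:R / n%:R \in `[0 : R, 1].
  by move=> kn; rewrite in_itv/= divr_ge0//= ler_pdivrMr// mul1r ler_nat.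
have x01' : 0 <= x <= 1 by move: x01; rewrite in_itv.
pose g k := e / 2 + C / n%:R ^+ 2 * (k%:R - n%:R * x) ^+ 2 : R.
have gE : (bernstein n g).[x] <= e.
  rewrite bernstein_affine bernstein_sqr subrr expr0n addr0.
  have -> : C / n%:R ^+ 2 * (n%:R * (x * (1 - x))) = C / n%:R * (x * (1 - x)).
    by field; rewrite gt_eqF.
  rewrite [leRHS]splitr lerD2l (le_trans _ nC)//.
  by rewrite ler_piMr ?divr_ge0 ?ltW//; nra.
have fg k : (k <= n)%N -> `|f x - f (k%:R / n%:R)| <= g k.
  move=> kn; rewrite (le_trans (osc _ _ x01 (kn01 _ kn)))// /g.
  rewrite le_eqVlt; apply/orP; left; apply/eqP.
  by field; rewrite gt_eqF.
rewrite -[f x](bernstein_cst n (f x) x) -bernsteinB ler_norml; apply/andP; split.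
  rewrite lerNl (le_trans _ gE)//.
  have -> : - (bernstein n ((fun=> f x) \- (fun k => f (k%:R / n%:R)))).[x] =
     (bernstein n (fun k => 0 + (-1) *
        ((fun=> f x) \- (fun k => f (k%:R / n%:R))) k)).[x].
    by rewrite bernstein_affine add0r mulN1r.
  apply: le_bernstein => // k kn; rewrite add0r mulN1r.
  by rewrite (le_trans _ (fg k kn))// -normrN ler_norm.
rewrite (le_trans _ gE)//; apply: le_bernstein => // k kn.
by rewrite (le_trans _ (fg k kn))//= ler_norm.
Qed.

Lemma weierstrass f : {within `[-1, 1], continuous f} ->
  forall e : R, 0 < e -> exists p : {poly R},
    forall x : R, x \in `[-1, 1] -> `|f x - p.[x]| <= e.
Proof.
move=> fc e e0; pose g (y : R) := f (2 * y - 1).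
have g01 y : y \in `[0, 1] -> 2 * y - 1 \in `[-1 : R, 1].
  by rewrite !in_itv/= => ?; lra.
have gc : {within `[0, 1], continuous g}.
  apply/subspace_continuousP => y y01.
  apply/cvgrPdist_lt => d d0.
  have [r r0 fr] := segment_uniform_continuous fc d0.
  rewrite near_withinE; exists (r / 2); first by rewrite /= divr_gt0.
  move=> z /= yz z01; apply: fr; [exact: g01|exact: g01|].
  have -> : 2 * y - 1 - (2 * z - 1) = 2 * (y - z) by ring.
  by rewrite normrM ger0_norm// mulrC -ltr_pdivlMr.
have [p gp] := weierstrass01 gc e0.
exists (p \Po (2^-1 *: ('X + 1))) => x x11.
have x01 : 2^-1 * (x + 1) \in `[0 : R, 1].
  by move: x11; rewrite !in_itv/= => ?; lra.
have := gp _ x01; rewrite horner_comp hornerZ hornerD hornerX hornerC /g.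
by have -> : 2 * (2^-1 * (x + 1)) - 1 = x by field.
Qed.

End Weierstrass.

(** * Power sums of the zeros as truncated power series *)

Section TruncatedSeries.
Variable F : numFieldType.
Implicit Types (p q f P : {poly F}) (N m n k : nat) (s : seq F).

(** Formal power series are handled as polynomials modulo ['X^N], with [N] beyond
    the orders of interest; congruence is divisibility of the difference. *)
Lemma dvdXnP N p : reflect (forall i, (i < N)%N -> p`_i = 0) ('X^N %| p).
Proof.
apply: (iffP idP) => [/dvdpP[q ->] i iN|p0]; first by rewrite coefMXn iN.
apply/dvdpP; exists (drop_poly N p).
rewrite -[LHS](poly_take_drop N p); suff -> : take_poly N p = 0 by rewrite add0r.
apply/polyP => i; rewrite coef_take_poly coef0; case: ltnP => // iN.
exact: p0.
Qed.

(** The factor ['X] restores the order of precision lost by differentiating. *)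
Lemma dvdXn_XderivM N p : 'X^N %| p -> 'X^N %| 'X * p^`().
Proof.
move=> /dvdXnP p0; apply/dvdXnP => -[|i] iN; rewrite coefXM//=.
by rewrite coef_deriv p0// mul0rn.
Qed.

Lemma dvdXn_cancel N f p : f`_0 != 0 -> 'X^N %| f * p -> 'X^N %| p.
Proof.
move=> f0; rewrite Gauss_dvdpr// coprimep_expl// coprimep_sym.
by rewrite -['X]subr0 -polyC0 coprimep_XsubC rootE horner_coef0.
Qed.

(** The polynomial [x ^ m * P (1 / x)]: expansions at infinity of quotients such as
    [P'/P] become power series in terms of the reversals. *)
Definition recip m P : {poly F} := \poly_(i < m.+1) P`_(m - i).

Lemma coef_recip m P i : (recip m P)`_i = if (i <= m)%N then P`_(m - i) else 0.
Proof. by rewrite coef_poly ltnS. Qed.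

Lemma recip_is_linear m : linear (recip m).
Proof.
move=> a p q; apply/polyP => i; rewrite coefD coefZ !coef_recip.
by case: ifP => _; rewrite ?coefD ?coefZ// mulr0 addr0.
Qed.

HB.instance Definition _ m :=
  GRing.isLinear.Build F {poly F} {poly F} _ (recip m) (recip_is_linear m).

Lemma recipZ m a P : recip m (a *: P) = a *: recip m P.
Proof. exact: linearZ. Qed.

Lemma recip_mulX m P : recip m.+1 ('X * P) = recip m P.
Proof.
apply/polyP => i; rewrite !coef_recip coefXM.
case: (leqP i m) => im; first by rewrite leqW// subSn.
by case: ifP => // _; rewrite (eqP im).
Qed.

Lemma recip_widen m P : (size P <= m.+1)%N -> recip m.+1 P = 'X * recip m P.
Proof.
move=> sP; apply/polyP => -[|i]; rewrite coefXM !coef_recip/=.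
  by rewrite subn0 nth_default.
by rewrite ltnS subSS.
Qed.

(** Euler's identity for the form of degree [m.+1] that homogenizes [P]. *)
Lemma recip_deriv m P :
  recip m P^`() = m.+1%:R *: recip m.+1 P - 'X * (recip m.+1 P)^`().
Proof.
apply/polyP => i; rewrite coefB coefZ coefXM coef_deriv !coef_recip coef_deriv.
case: i => [|i]/=; first by rewrite !subn0 subr0 mulr_natl.
rewrite ltnS subSS; case: ltngtP => im.
- rewrite subnSK// -[_ *+ i.+1]mulr_natl -mulrBl -natrB ?ltnS 1?ltnW//.
  by rewrite subSS mulr_natl.
- by rewrite mulr0 mul0rn subr0.
- by rewrite im mulr_natl subrr.
Qed.

(** Newton's identities: [p] agrees modulo ['X^N] with the power series
    [(m f - 'X f') / f].  When [f] is the reversal of a polynomial of degree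
    [m], the coefficients of that series are the power sums of its zeros. *)
Definition is_power_sums N m f p :=
  'X^N %| p * f - (m%:R *: f - 'X * f^`()).

Lemma is_power_sumsZ N m f p a : a != 0 ->
  is_power_sums N m (a *: f) p = is_power_sums N m f p.
Proof.
move=> a0; rewrite /is_power_sums derivZ -[RHS](dvdpZr _ _ a0).
by congr (_ %| _); rewrite -!mul_polyC; ring.
Qed.

(** Used for the Chebyshev polynomials, whose zeros then need no description. *)
Lemma is_power_sums_exists N m f : f`_0 != 0 ->
  exists p, is_power_sums N m f p.
Proof.
move=> f0; have /Bezout_coprimepP[[u v] /= uv1] : coprimep f 'X^N.
  rewrite coprimep_expr// -['X]subr0 -polyC0 coprimep_XsubC rootE.
  by rewrite horner_coef0.
have [c c0 uvE] : exists2 c, c != 0 & u * f + v * 'X^N = c%:P.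
  by move: uv1; rewrite -size_poly_eq1 => /size_poly1P.
exists (c^-1 *: u * (m%:R *: f - 'X * f^`())).
set g := _ - _; rewrite /is_power_sums -/g.
apply/dvdpP; exists (- c^-1 *: v * g).
have -> : c^-1 *: u * g * f - g =
    c^-1%:P * (u * f + v * 'X^N) * g - g + - c^-1 *: v * g * 'X^N.
  by rewrite -!mul_polyC polyCN; ring.
by rewrite uvE -polyCM mulVf// mul1r subrr add0r.
Qed.

(** Differentiating [P' = (P'/P) P] gives [P''/P] in terms of [P'/P].  When [f] is
    the reversal of [P], those of [P'] and [P''] are [g] and [m g - 'X g']. *)
Lemma power_sums_second_deriv N m f p (g := m.+1%:R *: f - 'X * f^`()) :
  is_power_sums N m.+1 f p ->
  'X^N %| (p ^+ 2 - p - 'X * p^`()) * f - (m%:R *: g - 'X * g^`()).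
Proof.
move=> pf; set A := p * f - g; have {}pf : 'X^N %| A by exact: pf.
have gE : g = p * f - A by rewrite /A subKr.
have XfE : 'X * f^`() = m.+1%:R *: f - g by rewrite /g subKr.
have XgE : 'X * g^`() = 'X * p^`() * f + p * (m.+1%:R *: f - g) - 'X * A^`().
  by rewrite {1}gE derivB derivM -XfE; ring.
have -> : (p ^+ 2 - p - 'X * p^`()) * f - (m%:R *: g - 'X * g^`()) =
    m%:R *: A + p * A - 'X * A^`().
  by rewrite XgE /A -!mul_polyC -natr1 polyCD polyC1; ring.
rewrite dvdp_sub ?dvdXn_XderivM//.
by rewrite dvdp_add// ?dvdp_mull// -mul_polyC dvdp_mull.
Qed.

(** [P''/P] is the product of [P''/P'] and [P'/P], that is, of [q] and [p]; equating
    it with the expression in [p] alone and cancelling [P] relates the zeros of [P']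
    to those of [P] without any error term. *)
Lemma power_sums_deriv N m f p q : f`_0 != 0 -> is_power_sums N m.+1 f p ->
  is_power_sums N m (m.+1%:R *: f - 'X * f^`()) q ->
  'X^N %| p * (q - p) + p + 'X * p^`().
Proof.
move=> f0 pf qg; pose g := m.+1%:R *: f - 'X * f^`(); rewrite -/g in qg *.
have h := power_sums_second_deriv pf; rewrite -/g in h.
rewrite /is_power_sums -/g in pf qg.
apply: (dvdXn_cancel f0).
have -> : f * (p * (q - p) + p + 'X * p^`()) =
  q * (p * f - g) + (q * g - (m%:R *: g - 'X * g^`()))
  - ((p ^+ 2 - p - 'X * p^`()) * f - (m%:R *: g - 'X * g^`())) by ring.
by rewrite dvdp_sub// dvdp_add// dvdp_mull.
Qed.

(** A second-order differential equation for [Y] is a Riccati equation for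
    [Y'/Y]. *)
Lemma power_sums_riccati N m a c Y p :
  (1 - 'X ^+ 2) * Y^`(2) - a *: ('X * Y^`()) + c *: Y = 0 ->
  (size Y <= m.+3)%N -> Y`_m.+2 != 0 ->
  is_power_sums N m.+2 (recip m.+2 Y) p ->
  'X^N %| (1 - 'X ^+ 2) * (p ^+ 2 - p - 'X * p^`()) + a *: p - c%:P.
Proof.
move=> ode sY Y0 pf.
set f := recip m.+2 Y in pf.
have f0 : f`_0 != 0 by rewrite coef_recip/= subn0.
pose g := m.+2%:R *: f - 'X * f^`(); pose h := m.+1%:R *: g - 'X * g^`().
have gE : recip m.+1 Y^`() = g by rewrite recip_deriv.
have hE : recip m Y^`(2) = h by rewrite derivSn derivn1 recip_deriv gE.
have sY2 : (size Y^`(2) <= m.+1)%N.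
  apply/leq_sizeP => j mj; rewrite coef_derivn nth_default ?mul0rn//.
  by rewrite (leq_trans sY)// !ltnS.
have odef : 'X * ('X * h) - h - a *: g + c *: f = 0.
  have := congr1 (recip m.+2) ode.
  rewrite raddf0 raddfD raddfB/= !recipZ mulrBl mul1r expr2 -mulrA raddfB/=.
  by rewrite !recip_mulX gE -/f (recip_widen (leqW sY2)) (recip_widen sY2) hE.
have := power_sums_second_deriv pf; rewrite -/g -/h => hf.
apply: (dvdXn_cancel f0).
have -> : f * ((1 - 'X ^+ 2) * (p ^+ 2 - p - 'X * p^`()) + a *: p - c%:P) =
  (1 - 'X ^+ 2) * ((p ^+ 2 - p - 'X * p^`()) * f - h) + a *: (p * f - g)
  - ('X * ('X * h) - h - a *: g + c *: f).
  by rewrite -!mul_polyC; ring.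
by rewrite odef subr0 dvdp_add ?dvdp_mull// -mul_polyC dvdp_mull.
Qed.

End TruncatedSeries.

Section PowerSumsOfZeros.
Variable F : numFieldType.
Implicit Types (x : F) (s : seq F) (N m n k : nat) (P : {poly F}).

Definition power_sums N s : {poly F} := \poly_(i < N) \sum_(x <- s) x ^+ i.

Lemma recip_XsubC_mul m x P : (size P <= m.+1)%N ->
  recip m.+1 (('X - x%:P) * P) = (1 - x *: 'X) * recip m P.
Proof.
move=> sP; rewrite mulrBl mul_polyC raddfB/= linearZ/= recip_mulX recip_widen//.
by rewrite mulrBl mul1r -scalerAl.
Qed.

Lemma recip_prod_XsubC s :
  recip (size s) (\prod_(x <- s) ('X - x%:P)) = \prod_(x <- s) (1 - x *: 'X).
Proof.
elim: s => [|x s IH] /=.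
  rewrite !big_nil; apply/polyP => -[|i]; rewrite coef_recip/= ?subn0//.
  by rewrite coef1.
by rewrite !big_cons recip_XsubC_mul ?IH// size_prod_XsubC.
Qed.

(** Each zero [x] contributes the geometric series of [1 / (1 - x 'X)]. *)
Lemma newton_identities N s : is_power_sums N (size s)
  (recip (size s) (\prod_(x <- s) ('X - x%:P))) (power_sums N s).
Proof.
rewrite recip_prod_XsubC; elim: s => [|x s IH].
  rewrite /is_power_sums !big_nil mulr1 scale0r derivC mulr0 !subr0.
  by apply/dvdXnP => i iN; rewrite coef_poly iN big_nil.
rewrite /is_power_sums big_cons; set f := \prod_(_ <- s) _ in IH *.
pose g : {poly F} := \poly_(i < N) x ^+ i.
have -> : power_sums N (x :: s) = g + power_sums N s.
  apply/polyP => i; rewrite coefD !coef_poly; case: ifP => _; last by rewrite addr0.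
  by rewrite big_cons.
have gE : 'X^N %| g * (1 - x *: 'X) - 1.
  apply/dvdXnP => i iN; rewrite coefB mulrBr mulr1 -scalerAr coefB coefZ coefMX.
  rewrite !coef_poly iN coef1; case: i iN => [|i] iN /=.
    by rewrite mulr0 subr0 expr0 subrr.
  by rewrite (ltnW iN) exprS !subrr.
set w := 1 - x *: 'X in gE *.
have -> : (g + power_sums N s) * (w * f)
    - ((size (x :: s))%:R *: (w * f) - 'X * (w * f)^`()) =
  f * (g * w - 1) +
  w * (power_sums N s * f - ((size s)%:R *: f - 'X * f^`())).
  rewrite derivM /w derivB derivC derivZ derivX /= -natr1.
  by rewrite -!mul_polyC polyCD polyC1; ring.
by rewrite dvdp_add ?dvdp_mull.
Qed.

End PowerSumsOfZeros.

(** * Chebyshev polynomials *)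

Section Chebyshev.
Variable F : numFieldType.
Implicit Types (n k : nat).

Fixpoint chebyshev2 n : {poly F} * {poly F} :=
  if n is m.+1 then let: (a, b) := chebyshev2 m in (b, 2 *: ('X * b) - a)
  else (1, 'X).

Definition chebyshev n : {poly F} := (chebyshev2 n).1.

Lemma chebyshevSS n :
  chebyshev n.+2 = 2 *: ('X * chebyshev n.+1) - chebyshev n.
Proof. by rewrite /chebyshev/=; case: (chebyshev2 n). Qed.

Lemma chebyshev_ind (P : nat -> Prop) :
  P 0 -> P 1 -> (forall n, P n -> P n.+1 -> P n.+2) -> forall n, P n.
Proof.
move=> P0 P1 PS n; suff [] : P n /\ P n.+1 by [].
by elim: n => [//|n [Pn Pn1]]; split => //; exact: PS.
Qed.

Lemma size_chebyshev_le n : (size (chebyshev n) <= n.+1)%N.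
Proof.
elim/chebyshev_ind: n => [||n IH IH1].
- by rewrite size_poly1.
- by rewrite size_polyX.
- rewrite chebyshevSS; apply/leq_sizeP => -[|j] nj //.
  rewrite coefB coefZ coefXM/= !nth_default ?mulr0 ?subr0//.
  + by rewrite (leq_trans IH)// ltnW// ltnW.
  + exact: leq_trans IH1 _.
Qed.

Lemma chebyshev_coef_top n : (chebyshev n)`_n != 0.
Proof.
case: n => [|n]; first by rewrite coef1 oner_neq0.
suff -> : (chebyshev n.+1)`_n.+1 = 2 ^+ n.
  by rewrite expf_neq0// pnatr_eq0.
elim: n => [|n IH]; first by rewrite coefX.
rewrite chebyshevSS coefB coefZ coefXM/= IH exprS.
by rewrite [X in _ - X]nth_default ?subr0// (leq_trans (size_chebyshev_le _)).
Qed.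

Lemma chebyshev_deriv n :
  (1 - 'X ^+ 2) * (chebyshev n)^`() =
    n%:R *: ('X * chebyshev n - chebyshev n.+1) /\
  (1 - 'X ^+ 2) * (chebyshev n.+1)^`() =
    n.+1%:R *: (chebyshev n - 'X * chebyshev n.+1).
Proof.
elim: n => [|n [IH0 IH1]].
  by rewrite /chebyshev/= derivC derivX; split; rewrite ?scale0r ?scale1r//; ring.
have SS := chebyshevSS n.
split.
  by rewrite IH1 SS -!mul_polyC; ring.
rewrite SS derivB derivZ derivM derivX mul1r.
set a := chebyshev n in IH0 IH1 *; set b := chebyshev n.+1 in IH0 IH1 *.
have -> : (1 - 'X ^+ 2) * (2 *: (b + 'X * b^`()) - a^`()) =
  2 *: ((1 - 'X ^+ 2) * b) + 2 *: ('X * ((1 - 'X ^+ 2) * b^`()))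
  - (1 - 'X ^+ 2) * a^`() by rewrite -!mul_polyC; ring.
rewrite IH0 IH1 -!mul_polyC -[n.+2%:R]natr1 -[n.+1%:R]natr1.
by rewrite !(polyCD, polyC1, polyCMn); ring.
Qed.

Lemma chebyshev_ode n :
  (1 - 'X ^+ 2) * (chebyshev n)^`(2) - 'X * (chebyshev n)^`()
  + n%:R ^+ 2 *: chebyshev n = 0.
Proof.
have X21 : (1 - 'X ^+ 2 : {poly F}) != 0.
  apply/eqP => /(congr1 (fun p : {poly F} => p`_0)).
  by rewrite coefB coef1 coefXn coef0 subr0 => /eqP; rewrite oner_eq0.
have [d0 d1] := chebyshev_deriv n.
set a := chebyshev n in d0 d1 *; set b := chebyshev n.+1 in d0 d1 *.
have db : n%:R *: b^`() = n.+1%:R *: ('X * a^`() + n%:R *: a).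
  apply: (mulfI X21).
  rewrite -scalerAr d1 -scalerAr mulrDr mulrCA d0 -!mul_polyC; ring.
have := congr1 deriv d0.
rewrite derivM derivZ derivB derivXn derivC derivB derivM derivX scalerBr db.
rewrite derivSn derivn1.
set a1 := a^`(); set a2 := a1^`() => H.
have {}H : (1 - 'X^2) * a2 = n%:R *: (1 * a + 'X * a1)
  - n.+1%:R *: ('X * a1 + n%:R *: a) + 2 *: ('X * a1).
  by rewrite -H -!mul_polyC /=; ring.
by rewrite H -!mul_polyC -natr1 !(polyCD, polyC1, polyC_exp); ring.
Qed.

Lemma chebyshev_derivn_ode n k :
  (1 - 'X ^+ 2) * (chebyshev n)^`(k)^`(2)
  - (2 * k%:R + 1) *: ('X * (chebyshev n)^`(k)^`())
  + (n%:R ^+ 2 - k%:R ^+ 2) *: (chebyshev n)^`(k) = 0.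
Proof.
elim: k => [|k IH].
  rewrite derivn0 mulr0 add0r scale1r expr0n subr0; exact: chebyshev_ode.
rewrite !(derivnS _ k); set Y := (chebyshev n)^`(k) in IH *.
have := congr1 deriv IH; rewrite linear0 !derivSn !derivn0 => {}IH.
rewrite -[RHS]IH !(derivD, derivN, derivM, derivZ, derivXn, derivC, derivX) /=.
by rewrite -!mul_polyC -natr1 !(polyCD, polyCN, polyC1, polyC_exp, polyCM, polyC_natr); ring.
Qed.

End Chebyshev.

(** * Stability of the recursion for the moments of successive derivatives *)

Section Stability.
Variable R : realFieldType.
Implicit Types (h : nat -> nat -> R) (n K N c k : nat).

(** The velocity of the [c]-th moment when one differentiation takes time [1 / n]. *)
Definition drift n h k c := n%:R * (h k.+1 c - h k c).

(** Here [h k c] stands for the [c]-th power sum of the zeros of [P^`(k)] divided by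
    [n], where [size P = n.+1]: one differentiation is one exact Euler step of length
    [1 / n] for a fixed triangular system of ordinary differential equations. *)
Definition euler_scheme N n K h :=
  (forall k, (k <= K)%N -> h k 0 = (n - k)%:R / n%:R) /\
  (forall k c, (k < K)%N -> (c < N)%N ->
    \sum_(i < c.+1) h k i * drift n h k (c - i) = - c.+1%:R * h k c).

(** The terms of the recursion at order [c.+1] with orders from 1 to [c] only. *)
Definition drift_lower_order n h k c :=
  \sum_(i < c) h k i.+1 * drift n h k (c - i).

Lemma drift0 N n K h k : euler_scheme N n K h -> (0 < n)%N -> (K <= n)%N ->
  (k < K)%N -> drift n h k 0 = -1.
Proof.
move=> [h0 _] n0 Kn kK; rewrite /drift !h0// 1?ltnW// -mulrBl.
have kn : (k < n)%N by apply: leq_trans Kn.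
rewrite [in X in X - _](natrB _ kn) natrB 1?ltnW// -natr1.
have : n%:R != 0 :> R by rewrite pnatr_eq0 -lt0n.
by move=> ?; field.
Qed.

Lemma driftS N n K h k c : euler_scheme N n K h -> (0 < n)%N -> (K <= n)%N ->
  (k < K)%N -> (c.+1 < N)%N ->
  (n - k)%:R / n%:R * drift n h k c.+1 =
  - c.+1%:R * h k c.+1 - drift_lower_order n h k c.
Proof.
move=> hE n0 Kn kK cN; have [h0 /(_ k c.+1 kK cN)] := hE.
rewrite big_ord_recr big_ord_recl /= subn0 subnn h0 1?ltnW// (drift0 hE)//.
have -> : \sum_(i < c) h k (bump 0 i) * drift n h k (c.+1 - bump 0 i) =
  drift_lower_order n h k c by [].
by rewrite -[c.+2%:R]natr1 => H; lra.
Qed.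

Lemma ler_normM2 (x y a b : R) : `|x| <= a -> `|y| <= b -> `|x * y| <= a * b.
Proof. by move=> xa yb; rewrite normrM ler_pM. Qed.

Lemma ler_norm_sum_const m (F : 'I_m -> R) B :
  (forall i, `|F i| <= B) -> `|\sum_(i < m) F i| <= m%:R * B.
Proof.
move=> FB; rewrite (le_trans (ler_norm_sum _ _ _))//.
rewrite (le_trans (ler_sum _ (fun i _ => FB i)))//.
by rewrite sumr_const card_ord mulr_natl.
Qed.

(** The step for the [c]-th moment has derivative [- c / (n - k)] in that moment
    itself, so it contracts; only the moments of lower order, which are treated
    first, can drive two solutions apart. *)
Lemma euler_stability (d : R) c : 0 < d -> exists2 C, 0 <= C &
  forall N n K h h' (e : R), (0 < n)%N -> (K <= n)%N -> (c < N)%N ->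
    c%:R <= d * n%:R -> d * n%:R <= (n - K)%:R -> 0 <= e <= 1 ->
    euler_scheme N n K h -> euler_scheme N n K h' ->
    (forall k i, (k <= K)%N -> (i <= c)%N -> `|h k i| <= 1) ->
    (forall i, (i <= c)%N -> `|h 0 i - h' 0 i| <= e) ->
  (forall k i, (k <= K)%N -> (i <= c)%N -> `|h k i - h' k i| <= C * e) /\
  (forall k i, (k < K)%N -> (i <= c)%N ->
     `|drift n h k i - drift n h' k i| <= C * e /\ `|drift n h k i| <= C).
Proof.
move=> d0; elim: c => [|c [C C0 IH]].
  exists 1 => // N n K h h' e n0 Kn cN _ _ /andP[e0 e1] hE hE' _ _; split.
    move=> k i kK; rewrite leqn0 => /eqP ->.
    by rewrite hE.1// hE'.1// subrr normr0 mul1r.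
  move=> k i kK; rewrite leqn0 => /eqP ->.
  by rewrite !(drift0 (N := N) (K := K))// subrr normr0 mul1r normrN normr1.
(* Relative to [e]: [B] bounds the difference of the driving terms, [C1] that of
   the moments and [C2] that of the drifts of order [c.+1]; [C3] bounds the drift
   itself. *)
pose B := c%:R * (C * C + (1 + C) * C).
pose C1 := 1 + B / d.
pose C2 := (c.+1%:R * C1 + B) / d.
pose C3 := (c.+1%:R + c%:R * C) / d.
have B0 : 0 <= B by rewrite mulr_ge0 ?addr_ge0 ?mulr_ge0 ?addr_ge0.
have C10 : 0 <= C1 by rewrite addr_ge0// divr_ge0// ltW.
have C20 : 0 <= C2 by rewrite divr_ge0 ?(ltW d0)// addr_ge0// mulr_ge0.
have C30 : 0 <= C3 by rewrite divr_ge0 ?(ltW d0)// addr_ge0// mulr_ge0.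
exists (C + C1 + C2 + C3); first by do 3! apply: addr_ge0 => //.
move=> N n K h h' e n0 Kn cN cdn dnK /andP[e0 e1] hE hE' h1 he.
have cdn' : c%:R <= d * n%:R by rewrite (le_trans _ cdn)// ler_nat.
have e01 : 0 <= e <= 1 by rewrite e0.
have [||IH1 IH2] := IH N n K h h' e n0 Kn (ltnW cN) cdn' dnK e01 hE hE'.
- by move=> k i kK ic; apply: h1 => //; exact: leqW.
- by move=> i ic; apply: he; exact: leqW.
have n0R : 0 < n%:R :> R by rewrite ltr0n.
pose L k := drift_lower_order n h k c; pose L' k := drift_lower_order n h' k c.
have LB k : (k < K)%N -> `|L k| <= c%:R * C.
  move=> kK; apply: ler_norm_sum_const => i; rewrite -[C]mul1r.
  apply: ler_normM2; first by apply: h1; [exact: ltnW|exact: leqW].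
  by apply: (IH2 k _ kK _).2; exact: leq_subr.
have LL k : (k < K)%N -> `|L k - L' k| <= B * e.
  move=> kK; rewrite /L /L' /drift_lower_order -sumrB /B -mulrA.
  apply: ler_norm_sum_const => i.
  have [dd dC] := IH2 k (c - i)%N kK (leq_subr _ _).
  have hh := IH1 k i.+1 (ltnW kK) (ltn_ord i).
  have h'1 : `|h' k i.+1| <= 1 + C.
    rewrite -[h' _ _](subKr (h k i.+1)) (le_trans (ler_normB _ _))//.
    rewrite lerD//; first by apply: h1; [exact: ltnW|exact: leqW].
    by rewrite (le_trans hh)// ler_piMr.
  rewrite (_ : _ - _ = (h k i.+1 - h' k i.+1) * drift n h k (c - i)
     + h' k i.+1 * (drift n h k (c - i) - drift n h' k (c - i))); last by ring.
  rewrite (le_trans (ler_normD _ _))// [leRHS]mulrDl lerD//.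
    by rewrite [_ * _ * e]mulrAC; exact: ler_normM2.
  by rewrite -mulrA; exact: ler_normM2.
have nkd k : (k < K)%N -> d <= (n - k)%:R / n%:R.
  move=> kK; rewrite ler_pdivlMr// (le_trans dnK)// ler_nat leq_sub2l//.
  exact: ltnW.
pose E k := h k c.+1 - h' k c.+1.
have dE k : (k < K)%N -> drift n h k c.+1 - drift n h' k c.+1 =
    - (c.+1%:R * E k + (L k - L' k)) / ((n - k)%:R / n%:R).
  move=> kK; have nk0 := lt_le_trans d0 (nkd k kK).
  apply: (mulIf (lt0r_neq0 nk0)); rewrite mulfVK ?lt0r_neq0//.
  rewrite mulrC mulrBr (driftS hE)// (driftS hE')// /E /L /L'; ring.
(* The factor [1 - c.+1 / (n - k)] lies between 0 and 1 because
   [c.+1 <= d * n <= n - K <= n - k]; each step thus adds at most [B * e / (d * n)]. *)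
have E1 k : (k <= K)%N -> `|E k| <= e + k%:R * (B * e / (d * n%:R)).
  elim: k => [_|k IHk kK]; first by rewrite mul0r addr0 he.
  have nk : d * n%:R <= (n - k)%:R.
    by rewrite (le_trans dnK)// ler_nat leq_sub2l// ltnW.
  have nk0 : 0 < (n - k)%:R :> R by rewrite (lt_le_trans _ nk)// mulr_gt0.
  have -> : E k.+1 = E k * (1 - c.+1%:R / (n - k)%:R) - (L k - L' k) / (n - k)%:R.
    have := dE k kK; rewrite /drift -mulrBr => H.
    have -> : E k.+1 = E k +
      n%:R * (h k.+1 c.+1 - h k c.+1 - (h' k.+1 c.+1 - h' k c.+1)) / n%:R.
      by rewrite mulrAC divff ?lt0r_neq0// mul1r /E; ring.
    rewrite H; field; by rewrite !lt0r_neq0.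
  rewrite (le_trans (ler_normB _ _))// -[k.+1%:R]natr1 [(_ + 1) * _]mulrDl mul1r addrA lerD//.
    rewrite (le_trans _ (IHk (ltnW kK)))// normrM ler_piMr//.
    rewrite ger0_norm ?lerBlDr ?lerDl ?divr_ge0//.
    by rewrite subr_ge0 ler_pdivrMr// mul1r (le_trans cdn).
  rewrite normrM normfV (ger0_norm (ltW nk0)).
  rewrite ler_pM ?LL ?invr_ge0 ?(ltW nk0)//.
  by rewrite lef_pV2 ?posrE ?mulr_gt0.
have EC k : (k <= K)%N -> `|E k| <= C1 * e.
  move=> kK; rewrite (le_trans (E1 k kK))// /C1 mulrDl mul1r lerD2l.
  have -> : B * e / (d * n%:R) = B / d * e / n%:R.
    by field; rewrite !lt0r_neq0.
  rewrite mulrA ler_pdivrMr// mulrC ler_wpM2l// ?ler_nat ?(leq_trans kK)//.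
  by rewrite mulr_ge0// divr_ge0// ltW.
split=> k i kK; rewrite leq_eqVlt => /predU1P[->|].
- rewrite (le_trans (EC k kK))// ler_wpM2r//; lra.
- rewrite ltnS => ic; rewrite (le_trans (IH1 k i kK ic))// ler_wpM2r//; lra.
- have dk := nkd k kK; have nk0 := lt_le_trans d0 dk.
  have iV : ((n - k)%:R / n%:R)^-1 <= d^-1 by rewrite lef_pV2 ?posrE.
  have iV0 : 0 <= ((n - k)%:R / n%:R)^-1 :> R by rewrite invr_ge0 ltW.
  split.
    rewrite dE// normrM normrN (ger0_norm iV0).
    apply: (@le_trans _ _ (C2 * e)); last by rewrite ler_wpM2r//; lra.
    rewrite /C2 mulrAC ler_pM// mulrDl (le_trans (ler_normD _ _))//.
    rewrite lerD ?LL// -mulrA ler_normM2 ?EC 1?ltnW//.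
    by rewrite ger0_norm.
  apply: (@le_trans _ _ C3); last by lra.
  have -> : drift n h k c.+1 = (- c.+1%:R * h k c.+1 - L k) / ((n - k)%:R / n%:R).
    by rewrite -(driftS hE)// mulrC mulKf ?lt0r_neq0.
  rewrite normrM (ger0_norm iV0) /C3 ler_pM//.
  rewrite (le_trans (ler_normB _ _))// lerD ?LB//.
  rewrite -[leRHS]mulr1 ler_normM2 ?(h1 _ _ (ltnW kK))//.
  by rewrite normrN ger0_norm.
- rewrite ltnS => ic; have [dd dC] := IH2 k i kK ic; split.
    by rewrite (le_trans dd)// ler_wpM2r//; lra.
  by rewrite (le_trans dC)//; lra.
Qed.

End Stability.

(** * Recursions satisfied by the moments *)

Section SchemesFromPolynomials.
Variable R : realFieldType.
Implicit Types (P p q : {poly R}) (N n k c K : nat) (u M : nat -> R).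

(** The coefficients of the identity [p (q - p) = - p - 'X p']; the moment of order 0
    only records the degree. *)
Lemma deriv_euler_scheme N n K P (p : nat -> {poly R}) :
  (0 < N)%N -> (0 < n)%N -> (K <= n)%N -> P`_n != 0 ->
  (forall k, (k <= K)%N ->
     is_power_sums N (n - k) (recip (n - k) P^`(k)) (p k)) ->
  euler_scheme N n K (fun k c => (p k)`_c / n%:R).
Proof.
move=> N0 n0 Kn Pn pP.
have n0R : n%:R != 0 :> R by rewrite pnatr_eq0 -lt0n.
have top k : (k <= K)%N -> (recip (n - k) P^`(k))`_0 != 0.
  move=> kK; rewrite coef_recip/= subn0 coef_derivn subnKC ?(leq_trans kK)//.
  by rewrite -mulr_natr mulf_neq0// pnatr_eq0 -lt0n ffact_gt0 (leq_trans kK).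
split=> [k kK|k c kK cN].
  have /dvdXnP/(_ _ N0) := pP k kK.
  rewrite coefB coefB coefZ coefXM/= subr0 coefM big_ord_recl big_ord0 addr0/=.
  by rewrite -mulrBl => /eqP; rewrite mulf_eq0 (negbTE (top k kK)) orbF subr_eq0
    => /eqP ->.
have pk := pP k (ltnW kK); have pk1 := pP k.+1 kK.
have nk : (n - k = (n - k.+1).+1)%N by rewrite subnSK// (leq_trans kK).
have := top k (ltnW kK); rewrite nk in pk * => topk.
rewrite derivnS recip_deriv in pk1.
have /dvdXnP/(_ _ cN) := power_sums_deriv topk pk pk1.
rewrite !coefD coefM coefXM -/(p k).
have -> : (if c == 0%N then 0 else ((p k)^`())`_c.-1) = c%:R * (p k)`_c.
  by case: c cN => [|c] _ /=; rewrite ?mul0r// coef_deriv mulr_natl.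
move=> H; rewrite /drift.
under eq_bigr do rewrite -mulrBl [n%:R * _]mulrC divfK// -coefB mulrAC.
rewrite -mulr_suml mulNr mulrA -mulNr; congr (_ / _).
by rewrite -natr1; lra.
Qed.

Definition selfconv u c := \sum_(i < c.+1) u i * u (c - i)%N.

(** The Riccati equation of [Y'/Y] for a derivative [Y] of a Chebyshev polynomial,
    divided by [n ^ 2]: all terms that come from derivatives of [p] acquire a
    factor [1 / n]. *)
Lemma chebyshev_riccati N n k p : (k.+2 <= n)%N ->
  is_power_sums N (n - k) (recip (n - k) (chebyshev R n)^`(k)) p ->
  let u c := p`_c / n%:R in forall c, (c < N)%N ->
  (selfconv u c - c.+1%:R / n%:R * u c)
  - (if c is b.+2 then selfconv u b - b.+1%:R / n%:R * u b else 0)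
  + (2 * (k%:R / n%:R) + n%:R^-1) * u c = (c == 0)%:R * (1 - (k%:R / n%:R) ^+ 2).
Proof.
move=> kn pT u c cN.
have n0R : n%:R != 0 :> R by rewrite pnatr_eq0 -lt0n (leq_trans _ kn).
have nk : (n - k = (n - k.+2).+2)%N by rewrite !subnSK// ltnW.
rewrite nk in pT.
have := power_sums_riccati (chebyshev_derivn_ode R n k) _ _ pT.
have -> : (size (chebyshev R n)^`(k) <= (n - k.+2).+3)%N.
  rewrite -nk; apply/leq_sizeP => j mj; rewrite coef_derivn nth_default ?mul0rn//.
  by rewrite (leq_trans (size_chebyshev_le _ _))//; lia.
rewrite -nk; have -> : ((chebyshev R n)^`(k))`_(n - k) != 0.
  rewrite coef_derivn subnKC; last by rewrite ltnW// ltnW.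
  rewrite -mulr_natr mulf_neq0 ?chebyshev_coef_top//.
  by rewrite pnatr_eq0 -lt0n ffact_gt0 ltnW// ltnW.
move=> /(_ isT isT)/dvdXnP/(_ _ cN).
set r := p ^+ 2 - p - _.
have rE b : r`_b / n%:R ^+ 2 = selfconv u b - b.+1%:R / n%:R * u b.
  have -> : r`_b = \sum_(i < b.+1) p`_i * p`_(b - i) - b.+1%:R * p`_b.
    have XE : ('X * p^`())`_b = b%:R * p`_b.
      by case: b => [|b]; rewrite coefXM/= ?mul0r// coef_deriv mulr_natl.
    by rewrite /r expr2 !coefB coefM XE -natr1 mulrDl mul1r opprD addrA addrAC.
  rewrite mulrBl mulr_suml /selfconv /u; congr (_ - _); last first.
    by move: (p`_b) => pb; field.
  by apply: eq_bigr => i _; rewrite mulf_div.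
rewrite coefB coefD mulrBl mul1r coefB coefXnM coefC coefZ -rE -/(u c).
have -> : (if c is b.+2 then selfconv u b - b.+1%:R / n%:R * u b else 0) =
  (if (c < 2)%N then 0 else r`_(c - 2)) / n%:R ^+ 2.
  by case: (c) => [|[|b]] /=; rewrite ?mul0r// subSS subSS subn0 rE.
rewrite /u; move: r`_c (if (c < 2)%N then _ else _) p`_c => rc rb pc H.
have {H} rcE : rc = rb - (2 * k%:R + 1) * pc + (c == 0)%:R * (n%:R ^+ 2 - k%:R ^+ 2).
  by case: (c == 0) H => /= H; rewrite ?mul1r ?mul0r; lra.
by rewrite {}rcE; field.
Qed.

End SchemesFromPolynomials.

(** * Convergence of the moments *)

Section MomentLimits.
Variable R : realType.
Implicit Types (t : R) (M : nat -> R) (N n c : nat).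

(** The coefficients of the solution [m] of [(1 - y ^ 2) m ^ 2 + 2 t m = 1 - t ^ 2]
    with constant term [1 - t], the limit of the Riccati equations above. *)
Definition limit_moments t M := M 0 = 1 - t /\
  forall c, selfconv M c - (if c is b.+2 then selfconv M b else 0)
    + 2 * t * M c = (c == 0)%:R * (1 - t ^+ 2).

Lemma cvg_invn : (n%:R^-1 : R) @[n --> \oo] --> 0.
Proof.
have n0 : \forall n \near \oo, 0 < n%:R :> R.
  by near=> n; rewrite ltr0n; near: n; exists 1%N.
by apply/(gtr0_cvgV0 n0); exact: cvgr_idn.
Unshelve. all: by end_near. Qed.

Lemma cvg_selfconv (u : nat -> nat -> R) M c :
  (forall i, (i <= c)%N -> u n i @[n --> \oo] --> M i) ->
  selfconv (u n) c @[n --> \oo] --> selfconv M c.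
Proof.
move=> uM; apply: cvg_big => [|i _]; first exact: add_continuous.
  apply: cvgM; apply: uM; last exact: leq_subr.
by rewrite -ltnS.
Qed.

(** In degree [c] the Riccati equation reads [(2 - c / n) u_c = ...] in terms of
    the [u_i] with [i < c], since [u_0 + k / n = 1]. *)
Lemma riccati_cvg N t M (x : nat -> R) (u : nat -> nat -> R) :
  x n @[n --> \oo] --> t -> limit_moments t M ->
  (\forall n \near \oo, u n 0%N = 1 - x n) ->
  (\forall n \near \oo, forall c, (c < N)%N ->
    (selfconv (u n) c - c.+1%:R / n%:R * u n c)
    - (if c is b.+2 then selfconv (u n) b - b.+1%:R / n%:R * u n b else 0)
    + (2 * x n + n%:R^-1) * u n c = (c == 0)%N%:R * (1 - x n ^+ 2)) ->
  forall c, (c < N)%N -> u n c @[n --> \oo] --> M c.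
Proof.
move=> xt [M0 MS] u0 uS c.
elim/ltn_ind: c => -[_ _|c IH cN].
  rewrite M0; have : 1 - x n @[n --> \oo] --> 1 - t by apply: cvgB => //; exact: cvg_cst.
  apply: cvg_trans; apply: near_eq_cvg; near=> n; apply/esym.
  by near: n.
have selfconvS (v : nat -> R) : selfconv v c.+1 =
    2 * v 0 * v c.+1 + \sum_(i < c) v i.+1 * v (c - i)%N.
  rewrite /selfconv big_ord_recr big_ord_recl /= subn0 subnn.
  rewrite (eq_bigr (fun i : 'I_c => v i.+1 * v (c - i)%N)) //.
  by move: (\sum_(_ < _) _) => s; ring.
pose G n := if c is b.+1 then selfconv (u n) b - b.+1%:R / n%:R * u n b else 0.
pose GM := if c is b.+1 then selfconv M b else 0.
pose P n := \sum_(i < c) u n i.+1 * u n (c - i)%N.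
pose PM := \sum_(i < c) M i.+1 * M (c - i)%N.
have invn := cvg_invn.
have cG : G n @[n --> \oo] --> GM.
  rewrite /G /GM; case: (c) IH cN => [|b] IH cN; first exact: cvg_cst.
  have -> : selfconv M b = selfconv M b - b.+1%:R * 0 * M b.
    by rewrite mulr0 mul0r subr0.
  apply: cvgB.
    apply: cvg_selfconv => i ib; apply: IH; first by rewrite ltnS leqW.
    by rewrite (leq_ltn_trans ib)// ltnW// ltnW.
  apply: cvgM; last by apply: IH => //; rewrite ltnW// ltnW.
  by apply: cvgM => //; exact: cvg_cst.
have cP : P n @[n --> \oo] --> PM.
  apply: cvg_big => [|i _]; first exact: add_continuous.
  apply: cvgM; apply: IH.
  - by rewrite ltnS ltn_ord.
  - by rewrite (leq_ltn_trans _ cN)// ltnW// ltnS.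
  - by rewrite ltnS leq_subr.
  - by rewrite (leq_ltn_trans _ cN)// (leq_trans (leq_subr _ _)).
have -> : M c.+1 = (GM - PM) / (2 - c.+1%:R * 0).
  have := MS c.+1; rewrite selfconvS M0 /= mul0r => H.
  have {}H : M c.+1 * 2 = GM - PM.
    by move: H; rewrite /GM /PM; case: (c) => [|b]; move: (\sum_(_ < _) _) => s H; lra.
  by rewrite -H mulr0 subr0 mulfK// pnatr_eq0.
have : (G n - P n) / (2 - c.+1%:R * n%:R^-1) @[n --> \oo] -->
    (GM - PM) / (2 - c.+1%:R * 0).
  apply: cvgM; first exact: cvgB.
  apply: cvgV; first by rewrite mulr0 subr0 pnatr_eq0.
  by apply: cvgB; [exact: cvg_cst|apply: cvgM => //; exact: cvg_cst].
apply: cvg_trans; apply: near_eq_cvg; near=> n.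
have n0 : (c.+1 < n)%N by near: n; exists c.+2.
have nR : 0 < n%:R :> R by rewrite ltr0n (leq_trans _ n0).
have den : 0 < 2 - c.+1%:R * n%:R^-1 :> R.
  rewrite subr_gt0 -[_ * _^-1]/(_ / _) ltr_pdivrMr// (@lt_trans _ _ n%:R) ?ltr_nat//.
  by lra.
have xn : u n 0 = 1 - x n by near: n.
have : forall c, (c < N)%N ->
    (selfconv (u n) c - c.+1%:R / n%:R * u n c)
    - (if c is b.+2 then selfconv (u n) b - b.+1%:R / n%:R * u n b else 0)
    + (2 * x n + n%:R^-1) * u n c = (c == 0)%N%:R * (1 - x n ^+ 2) by near: n.
move=> /(_ c.+1 cN); rewrite /= selfconvS xn mul0r => H.
apply: (mulIf (lt0r_neq0 den)); rewrite divfK ?lt0r_neq0//.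
have {}H : 2 * (1 - x n) * u n c.+1 + P n - c.+2%:R / n%:R * u n c.+1 - G n +
    (2 * x n + n%:R^-1) * u n c.+1 = 0.
  by rewrite -H /G /P; case: (c).
move: H; rewrite -[c.+2%:R]natr1.
move: (G n) (P n) (u n c.+1) (x n) (n%:R^-1) => g p v y w H.
by lra.
Unshelve. all: by end_near. Qed.

Definition zeros_in_unit_interval (P : {poly R}) (s : seq R) :=
  P = lead_coef P *: \prod_(x <- s) ('X - x%:P) /\
  {in s, forall x, x \in `[-1, 1]}.

(** The Chebyshev polynomials have the same limits of initial moments, by the Riccati
    equation at [k = 0]; by stability the moments of the two sequences then stay close
    up to [k n], where those of the Chebyshev polynomials are known. *)
Lemma deriv_moments_cvg (P : nat -> {poly R}) (xs : nat -> nat -> seq R)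
    (k : nat -> nat) t M0 M :
  0 <= t < 1 -> (k n)%:R / n%:R @[n --> \oo] --> t ->
  (forall n, (0 < n)%N -> size (P n) = n.+1) ->
  (forall n j, (0 < n)%N -> (j < n)%N ->
    zeros_in_unit_interval (P n)^`(j) (xs n j)) ->
  limit_moments 0 M0 -> limit_moments t M ->
  (forall c, (\sum_(x <- xs n 0%N) x ^+ c) / n%:R @[n --> \oo] --> M0 c) ->
  forall c, (\sum_(x <- xs n (k n)) x ^+ c) / n%:R @[n --> \oo] --> M c.
Proof.
move=> /andP[t0 t1] kt sP xsP M0P MP M0cvg c.
pose N := c.+1; pose d := (1 - t) / 2.
have d0 : 0 < d by rewrite divr_gt0// subr_gt0.
have chebT n j : (j <= n)%N -> (recip (n - j) (chebyshev R n)^`(j))`_0 != 0.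
  move=> jn; rewrite coef_recip/= subn0 coef_derivn subnKC//.
  by rewrite -mulr_natr mulf_neq0 ?chebyshev_coef_top// pnatr_eq0 -lt0n ffact_gt0.
(* Only truncated series are chosen; the order [N] is just beyond [c]. *)
have /choice[pT pTP] : forall nj : nat * nat, exists p, (nj.2 <= nj.1)%N ->
    is_power_sums N (nj.1 - nj.2) (recip (nj.1 - nj.2) (chebyshev R nj.1)^`(nj.2)) p.
  move=> [n j]/=; have [jn|jn] := leqP j n; last by exists 0.
  by have [p pP] := is_power_sums_exists N (n - j) (chebT n j jn); exists p.
pose hT n j i := (pT (n, j))`_i / n%:R.
pose hQ n j i := (power_sums N (xs n j))`_i / n%:R.
have hQE n j i : (i < N)%N -> hQ n j i = (\sum_(x <- xs n j) x ^+ i) / n%:R.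
  by move=> iN; rewrite /hQ coef_poly iN.
have schemeT n K : (0 < n)%N -> (K <= n)%N -> euler_scheme N n K (hT n).
  move=> n0 Kn; apply: (deriv_euler_scheme (P := chebyshev R n)) => //.
    exact: chebyshev_coef_top.
  by move=> j jK; apply: (pTP (n, j)); exact: leq_trans Kn.
have top n : (0 < n)%N -> (P n)`_n != 0.
  move=> n0; have : lead_coef (P n) != 0.
    by rewrite lead_coef_eq0 -size_poly_gt0 sP.
  by rewrite lead_coefE sP.
have size_deriv n j : (0 < n)%N -> (j <= n)%N -> size (P n)^`(j) = (n - j).+1.
  move=> n0 jn; apply/eqP; rewrite eqn_leq; apply/andP; split.
    apply/leq_sizeP => i ji; rewrite coef_derivn nth_default ?mul0rn// sP//; lia.
  rewrite ltnNge; apply/negP => /leq_sizeP/(_ _ (leqnn _)).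
  rewrite coef_derivn subnKC// -mulr_natr => /eqP; rewrite mulf_eq0.
  by rewrite (negbTE (top n n0)) pnatr_eq0 -leqn0 leqNgt ffact_gt0 jn.
have lead_deriv n j : (0 < n)%N -> (j <= n)%N -> lead_coef (P n)^`(j) != 0.
  by move=> n0 jn; rewrite lead_coef_eq0 -size_poly_gt0 size_deriv.
have size_xs n j : (0 < n)%N -> (j < n)%N -> size (xs n j) = (n - j)%N.
  move=> n0 jn; have [PE _] := xsP n j n0 jn.
  apply: succn_inj; rewrite -(size_deriv n j n0 (ltnW jn)) [in RHS]PE.
  by rewrite size_scale ?size_prod_XsubC// lead_deriv// ltnW.
have schemeQ n K : (0 < n)%N -> (K < n)%N -> euler_scheme N n K (hQ n).
  move=> n0 Kn; apply: (deriv_euler_scheme (P := P n)) => //; first exact: ltnW.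
    exact: top.
  move=> j jK; have jn := leq_ltn_trans jK Kn.
  have [PE _] := xsP n j n0 jn.
  rewrite PE recipZ is_power_sumsZ ?lead_deriv ?(ltnW jn)//.
  by rewrite -(size_xs n j)//; exact: newton_identities.
have hQ1 n j i : (0 < n)%N -> (j < n)%N -> (i < N)%N -> `|hQ n j i| <= 1.
  move=> n0 jn iN; rewrite hQE// normrM normfV [`|n%:R|]ger0_norm//.
  rewrite ler_pdivrMr ?ltr0n// mul1r (le_trans (ler_norm_sum _ _ _))//.
  rewrite (@le_trans _ _ (\sum_(x <- xs n j) 1))//.
    rewrite big_seq [leRHS]big_seq ler_sum// => x xs_x.
    rewrite normrX exprn_ile1// ler_norml.
    by have [_ /(_ _ xs_x)] := xsP n j n0 jn; rewrite in_itv.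
  by rewrite big_const_seq count_predT iter_addr_0 size_xs// ler_nat leq_subr.
have invn := cvg_invn.
have cT0 i : (i < N)%N -> hT n 0 i @[n --> \oo] --> M0 i.
  move: i; apply: (riccati_cvg (t := 0) (x := fun n => 0%:R / n%:R)) => //.
  - by under eq_cvg do rewrite mul0r; exact: cvg_cst.
  - near=> n; have n0 : (0 < n)%N by near: n; exists 1%N.
    have [-> //] := schemeT n 0%N n0 isT.
    by rewrite subn0 mul0r subr0 divff// pnatr_eq0 -lt0n.
  - near=> n; apply: chebyshev_riccati; first by near: n; exists 2%N.
    by apply: (pTP (n, 0%N)).
have kd : \forall n \near \oo, d * n%:R <= (n - k n)%:R :> R /\ (k n < n)%N.
  have t2 : t < (1 + t) / 2 by lra.
  near=> n; have n0 : 0 < n%:R :> R by rewrite ltr0n; near: n; exists 1%N.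
  have : (k n)%:R / n%:R < (1 + t) / 2 by near: n; exact: (cvgr_lt _ kt).
  rewrite ltr_pdivrMr// => kn; have kn' : (k n < n)%N.
    rewrite -(ltr_nat R) (lt_le_trans kn)// ler_piMl ?ltW//; lra.
  by split=> //; rewrite natrB 1?ltnW// /d; lra.
have nbig (m : nat) : \forall n \near \oo, m%:R <= d * n%:R.
  near=> n; rewrite mulrC -ler_pdivrMr//.
  by near: n; exact: nbhs_infty_ger.
have cT : hT n (k n) c @[n --> \oo] --> M c.
  apply: (riccati_cvg (t := t) (N := N) (x := fun n => (k n)%:R / n%:R)
     (u := fun n => hT n (k n))) => //.
  - near=> n; have n0 : (0 < n)%N by near: n; exists 1%N.
    have [_ kn] : d * n%:R <= (n - k n)%:R /\ (k n < n)%N by near: n.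
    have [-> //] := schemeT n (k n) n0 (ltnW kn).
    by rewrite natrB 1?ltnW// mulrBl divff// pnatr_eq0 -lt0n.
  - near=> n; have [dk kn] : d * n%:R <= (n - k n)%:R /\ (k n < n)%N by near: n.
    have : 2%:R <= d * n%:R by near: n; exact: nbig.
    move=> /le_trans/(_ dk); rewrite ler_nat => k2.
    apply: chebyshev_riccati; first by lia.
    by apply: (pTP (n, k n)); exact: ltnW.
have [C C0 stab] := euler_stability c d0.
suff D0 : hQ n (k n) c - hT n (k n) c @[n --> \oo] --> 0.
  rewrite -[M c]add0r.
  have -> : (fun n => (\sum_(x <- xs n (k n)) x ^+ c) / n%:R) =
      (fun n => hQ n (k n) c - hT n (k n) c + hT n (k n) c).
    by apply/funext => n; rewrite subrK hQE.
  exact: cvgD.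
apply/cvgrPdist_le => e e0.
pose e1 := Num.min 1 (e / (C + 1)).
have e10 : 0 < e1 by rewrite lt_min ltr01 divr_gt0// ltr_wpDl.
have init : \forall n \near \oo, forall i : 'I_N, `|hQ n 0 i - hT n 0 i| <= e1.
  apply: filter_forall => i.
  have : hQ n 0 i - hT n 0 i @[n --> \oo] --> M0 i - M0 i.
    apply: cvgB; last exact: cT0.
    by under eq_cvg do rewrite hQE//; exact: M0cvg.
  rewrite subrr => /cvgrPdist_le/(_ _ e10).
  by apply: filterS => n; rewrite sub0r normrN.
near=> n.
have n0 : (0 < n)%N by near: n; exists 1%N.
have [dk kn] : d * n%:R <= (n - k n)%:R /\ (k n < n)%N by near: n.
have cn : c%:R <= d * n%:R by near: n; exact: nbig.
have e1b : 0 <= e1 <= 1 by rewrite ltW//= ge_min lexx.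
have [||sE _] := stab N n (k n) (hQ n) (hT n) e1 n0 (ltnW kn) (ltnSn c) cn dk e1b
  (schemeQ n _ n0 kn) (schemeT n _ n0 (ltnW kn)).
- by move=> j i jk ic; apply: hQ1 => //; exact: leq_ltn_trans kn.
- have Hn : forall i : 'I_N, `|hQ n 0 i - hT n 0 i| <= e1 by near: n.
  by move=> i ic; apply: (Hn (Ordinal (ic : (i < N)%N))).
rewrite sub0r normrN (le_trans (sE _ _ (leqnn _) (leqnn _)))//.
apply: (@le_trans _ _ (C * (e / (C + 1)))).
  by rewrite ler_wpM2l// ge_min lexx orbT.
rewrite mulrCA ler_piMr ?(ltW e0)// ler_pdivrMr ?mul1r ?lerDl//.
by rewrite ltr_wpDl.
Unshelve. all: by end_near. Qed.

End MomentLimits.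

(** * The moments of the limit measure as a power series *)

Section FormalMoments.
Variable R : realType.
Implicit Types (t : R) (A W : nat -> R).

(** The recursion says that [w = (1 - y ^ 2) A + t] solves
    [(1 - r y ^ 2) w' = - r y w], hence is the square root of [1 - r y ^ 2]. *)
Lemma limit_moments_of_recursion t A W : let r := 1 - t ^+ 2 in
  A 0 = 1 - t -> A 1 = 0 -> (forall c, A c.+2 = A c - W c) ->
  W 0 = r / 2 -> W 1 = 0 ->
  (forall c, c.+4%:R * W c.+2 = r * c.+1%:R * W c) ->
  limit_moments t A.
Proof.
move=> r A0 A1 AS W0 W1 WS; split=> // c.
pose N := c.+1; pose a : {poly R} := \poly_(i < N) A i.
have aE i : (i < N)%N -> a`_i = A i by move=> iN; rewrite coef_poly iN.
pose w := (1 - 'X ^+ 2) * a + t%:P.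
have wE i : (i < N)%N ->
    w`_i = match i with 0 => 1 | 1 => 0 | j.+2 => - W j end.
  move=> iN; rewrite coefD mulrBl mul1r coefB coefXnM coefC aE//.
  case: i iN => [|[|i]] iN /=; rewrite ?subr0 ?addr0 ?A0 ?A1 ?subrK//.
  by rewrite subSS subSS subn0 aE ?AS ?addr0 1?ltnW 1?ltnW//; lra.
(* The differential equation of [w], multiplied by ['X]. *)
pose z := (1 - r *: 'X ^+ 2) * ('X * w^`()) + r *: ('X ^+ 2 * w).
have z0 : 'X^N %| z.
  apply/dvdXnP => i iN.
  have XwE (j : nat) : ('X * w^`())`_j = j%:R * w`_j.
    by case: j => [|j]; rewrite coefXM/= ?mul0r// coef_deriv mulr_natl.
  rewrite /z mulrBl mul1r -scalerAl coefD coefB !coefZ !coefXnM XwE.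
  case: i iN => [|[|i]] iN /=; first by rewrite mulr0 mul0r subr0 addr0.
    by rewrite wE// !mulr0 subr0 addr0.
  have iN' : (i < N)%N by rewrite ltnW// ltnW.
  rewrite subSS subSS subn0 XwE (wE _ iN) (wE _ iN') => {iN'}.
  case: i iN => [|[|i]] iN.
  - by rewrite W0; lra.
  - by rewrite W1; lra.
  - have := WS i; rewrite -![_.+4%:R]natr1 -[i.+3%:R]natr1 -[i.+2%:R]natr1.
    by move: (W i) (W i.+2) => x y; lra.
pose D := w ^+ 2 - (1 - r *: 'X ^+ 2).
(* The defect [D] of [w ^ 2 = 1 - r y ^ 2] solves a homogeneous equation and has no
   constant term, hence vanishes. *)
have zD : 'X^N %| (1 - r *: 'X ^+ 2) * ('X * D^`()) + (2 * r) *: ('X ^+ 2 * D).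
  suff -> : (1 - r *: 'X ^+ 2) * ('X * D^`()) + (2 * r) *: ('X ^+ 2 * D) =
    2 *: w * z by apply: dvdp_mull; exact: z0.
  have -> : D^`() = w^`() * w + w * w^`() + r *: ('X *+ 2).
    by rewrite /D expr2 derivB derivM derivB derivC derivZ derivXn sub0r opprK.
  by rewrite /D /z -!mul_polyC polyCM; move: (w^`()) (w) => w' v; ring.
have D0 i : (i < N)%N -> D`_i = 0.
  elim/ltn_ind: i => i IH iN; case: i IH iN => [|i] IH iN.
    rewrite /D coefB expr2 coef0M wE// mulr1 coefB coefZ coefXn mulr0 coef1.
    by rewrite subr0 subrr.
  move/dvdXnP: zD => /(_ i.+1 iN).
  have XDE (j : nat) : ('X * D^`())`_j = j%:R * D`_j.
    by case: j => [|j]; rewrite coefXM/= ?mul0r// coef_deriv mulr_natl.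
  rewrite mulrBl mul1r -scalerAl coefD coefB !coefZ !coefXnM XDE.
  have -> : (if (i.+1 < 2)%N then 0 else ('X * D^`())`_(i.+1 - 2)) = 0.
    case: i IH iN => [|i] IH iN //=.
    by rewrite subSS subSS subn0 XDE IH ?mulr0// ltnW// ltnW.
  have -> : (if (i.+1 < 2)%N then 0 else D`_(i.+1 - 2)) = 0.
    case: i IH iN => [|i] IH iN //=.
    by rewrite subSS subSS subn0 IH// ltnW// ltnW.
  rewrite !mulr0 subr0 addr0 => /eqP; rewrite mulf_eq0 pnatr_eq0/= => /eqP.
  exact.
have : 'X^N %| (1 - 'X ^+ 2) * ((1 - 'X ^+ 2) * a ^+ 2 + (2 * t) *: a - r%:P).
  suff <- : D = (1 - 'X ^+ 2) * ((1 - 'X ^+ 2) * a ^+ 2 + (2 * t) *: a - r%:P).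
    by apply/dvdXnP.
  by rewrite /D /w -!mul_polyC /r polyCB polyC1 polyC_exp polyCM; ring.
have X0 : (1 - 'X ^+ 2 : {poly R})`_0 != 0.
  by rewrite coefB coef1 coefXn subr0 oner_eq0.
move=> /(dvdXn_cancel X0)/dvdXnP/(_ c (ltnSn c)).
rewrite coefB coefD mulrBl mul1r coefB coefXnM coefZ coefC aE// expr2.
have SE b : (b < N)%N -> (a * a)`_b = selfconv A b.
  move=> bN; rewrite coefM; apply: eq_bigr => i _.
  by rewrite !aE// (leq_ltn_trans _ bN)// ?leq_subr// -ltnS.
rewrite SE//; have -> : (if (c < 2)%N then 0 else (a * a)`_(c - 2)) =
    if c is b.+2 then selfconv A b else 0.
  have {}SE b : (b < c.+1)%N -> (a * a)`_b = selfconv A b by exact: SE.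
  case: (c) SE => [|[|b]] //= SE; rewrite subSS subSS subn0; apply: SE.
  by rewrite ltnW.
rewrite /r; move: (selfconv A c - _ + _) => x.
by case: (c == 0)%N => /= H; lra.
Qed.

End FormalMoments.

(** * Zeros of the derivatives *)

Section Zeros.
Variable R : realType.
Implicit Types (s : seq R) (P : {poly R}) (p : {poly R[i]}) (n j : nat).

Local Open Scope complex_scope.
Local Notation toC := (real_complex R).

Lemma prod_XsubC_deriv_horner (F : fieldType) (s : seq F) (w : F) : w \notin s ->
  (\prod_(x <- s) ('X - x%:P))^`().[w] =
  (\prod_(x <- s) ('X - x%:P)).[w] * \sum_(x <- s) (w - x)^-1.
Proof.
elim: s => [|x s IH]; first by rewrite !big_nil derivC horner0 mulr0.
rewrite inE negb_or => /andP[wx ws].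
rewrite !big_cons derivM derivB derivX derivC subr0 mul1r hornerD !hornerM IH//.
rewrite hornerXsubC mulrDr mulrA; congr (_ + _).
by rewrite mulrAC divff ?mul1r// subr_eq0.
Qed.

(** Outside the interval all the terms [1 / (w - x)] of [P' / P] have the same
    strict sign, either of their imaginary or of their real part. *)
Lemma gauss_lucas_unit_interval (s : seq R) (w : R[i]) :
  (0 < size s)%N -> {in s, forall x, x \in `[-1, 1]} ->
  root (\prod_(x <- s) ('X - (toC x)%:P))^`() w ->
  exists2 x : R, x \in `[-1, 1] & w = toC x.
Proof.
move=> s0 s1; rewrite -(big_map toC xpredT (fun z => 'X - z%:P)) => /rootP w0.
have [|ws] := boolP (w \in map toC s).
  by move=> /mapP[x xs ->]; exists x => //; exact: s1.
have {w0} : \sum_(z <- map toC s) (w - z)^-1 = 0.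
  apply/eqP; move: w0; rewrite prod_XsubC_deriv_horner// => /eqP.
  rewrite mulf_eq0 => /orP[|//]; rewrite -rootE root_prod_XsubC.
  by rewrite (negbTE ws).
rewrite big_map; case: w ws => a b ws sum0.
pose den (x : R) := (a - x) ^+ 2 + b ^+ 2.
have invE (x : R) : (a +i* b - toC x)^-1 = ((a - x) / den x) +i* (- (b / den x)).
  have -> : a +i* b - toC x = (a - x) +i* b.
    by apply/eqP; rewrite eq_complex /= subr0 !eqxx.
  by [].
have sumE : \sum_(x <- s) (a +i* b - toC x)^-1 =
    (\sum_(x <- s) (a - x) / den x) +i* (- (b * \sum_(x <- s) (den x)^-1)).
  elim: (s) => [|x l IH]; first by rewrite !big_nil mulr0 oppr0.
  by rewrite !big_cons IH invE mulrDr opprD.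
have den_gt0 x : x \in s -> 0 < den x.
  move=> xs; rewrite lt_def addr_ge0 ?sqr_ge0// andbT.
  rewrite paddr_eq0 ?sqr_ge0// !sqrf_eq0 subr_eq0; apply/negP => /andP[/eqP ax /eqP b0].
  by move/negP: ws; apply; apply/mapP; exists x => //; rewrite ax b0.
have sum_gt0 (g : R -> R) : (forall x, x \in s -> 0 < g x) -> 0 < \sum_(x <- s) g x.
  move=> g0; case: (s) s0 g0 => // x l _ g0; rewrite big_cons ltr_wpDr ?g0 ?mem_head//.
  by rewrite big_seq sumr_ge0// => y yl; rewrite ltW// g0// inE yl orbT.
move: sum0; rewrite sumE => -[re0 /eqP]; rewrite oppr_eq0 mulf_eq0 => /orP[|]; last first.
  by rewrite gt_eqF// sum_gt0// => x xs; rewrite invr_gt0 den_gt0.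
move=> /eqP b0; exists a; last by rewrite b0.
rewrite in_itv/=; apply/andP; split; rewrite leNgt; apply/negP => a1.
  have : 0 < \sum_(x <- s) (x - a) / den x.
    apply: sum_gt0 => x xs; rewrite divr_gt0 ?den_gt0// subr_gt0 (lt_le_trans a1)//.
    by have := s1 x xs; rewrite in_itv => /andP[].
  rewrite (eq_bigr (fun x => - ((a - x) / den x))) ?sumrN ?re0 ?oppr0 ?ltxx// => x _.
  by rewrite -mulNr opprB.
suff : 0 < \sum_(x <- s) (a - x) / den x by rewrite re0 ltxx.
apply: sum_gt0 => x xs; rewrite divr_gt0 ?den_gt0// subr_gt0 (le_lt_trans _ a1)//.
by have := s1 x xs; rewrite in_itv => /andP[].
Qed.

Lemma zerosE p : p = lead_coef p *: \prod_(z <- zeros p) ('X - z%:P).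
Proof. by rewrite /zeros; case: closed_field_poly_normal. Qed.

Lemma mem_zeros p z : p != 0 -> (z \in zeros p) = root p z.
Proof.
move=> p0; rewrite [in RHS](zerosE p) rootZ ?lead_coef_eq0//.
by rewrite root_prod_XsubC.
Qed.

Definition real_zeros p : seq R := map (@complex.Re R) (zeros p).

Definition roots_in_unit_interval p :=
  forall z, root p z -> exists2 x : R, x \in `[-1, 1] & z = toC x.

Lemma real_zeros_itv p : p != 0 -> roots_in_unit_interval p ->
  {in real_zeros p, forall x, x \in `[-1, 1]}.
Proof.
move=> p0 p1 _ /mapP[z zp ->]; move: zp; rewrite mem_zeros//.
by move=> /p1[x x1 ->].
Qed.

Lemma real_zerosE p : p != 0 -> roots_in_unit_interval p ->
  p = lead_coef p *: map_poly toC (\prod_(x <- real_zeros p) ('X - x%:P)).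
Proof.
move=> p0 p1; rewrite [LHS]zerosE; congr (_ *: _).
rewrite rmorph_prod/= big_map big_seq [RHS]big_seq; apply: eq_bigr => z.
rewrite mem_zeros// => /p1[x _ ->].
by rewrite rmorphB/= map_polyX map_polyC.
Qed.

Lemma derivn_neq0 p n j : size p = n.+1 -> (j <= n)%N -> p^`(j) != 0.
Proof.
move=> sp jn; apply: contraTneq isT => pj0.
have : (p^`(j))`_(n - j) != 0.
  rewrite coef_derivn subnKC// -mulr_natr mulf_neq0//.
    by rewrite -[n]/(n.+1.-1) -sp -lead_coefE lead_coef_eq0 -size_poly_gt0 sp.
  by rewrite pnatr_eq0 -lt0n ffact_gt0.
by rewrite pj0 coef0 eqxx.
Qed.

Lemma derivn_roots_in_unit_interval p n j : size p = n.+1 -> (j <= n)%N ->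
  roots_in_unit_interval p -> roots_in_unit_interval p^`(j).
Proof.
move=> sp + p1; elim: j => [//|j IH] jn z; rewrite derivnS.
have pj0 := derivn_neq0 sp (ltnW jn); have {}IH := IH (ltnW jn).
rewrite (real_zerosE pj0 IH) derivZ rootZ ?lead_coef_eq0// rmorph_prod/=.
rewrite (eq_bigr (fun x => 'X - (toC x)%:P)); last first.
  by move=> x _; rewrite rmorphB/= map_polyX map_polyC.
apply: gauss_lucas_unit_interval; last exact: real_zeros_itv.
rewrite lt0n; apply: contra_neqN (derivn_neq0 sp jn) => /nilP s0.
by rewrite derivnS (real_zerosE pj0 IH) s0 big_nil rmorph1 derivZ derivC scaler0.
Qed.

Lemma normalization_neq0 n j :
  (n - j)`!%:R / n`!%:R != 0 :> R[i].
Proof. by rewrite mulf_neq0 ?invr_eq0// pnatr_eq0 -lt0n fact_gt0. Qed.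

(** The complex polynomials [Q n] may be replaced by monic real ones: the zeros are
    real, and scalar factors commute with differentiation. *)
Lemma real_zeros_normalized_derivative (Q : nat -> {poly R[i]}) n j :
  size (Q n) = n.+1 -> roots_in_unit_interval (Q n) -> (j <= n)%N ->
  zeros_in_unit_interval
    (\prod_(x <- real_zeros (normalized_derivative Q n 0)) ('X - x%:P))^`(j)
    (real_zeros (normalized_derivative Q n j)).
Proof.
move=> sQ Q1 jn.
have c0 i := normalization_neq0 n i.
have nd0 i : (i <= n)%N -> normalized_derivative Q n i != 0.
  by move=> i_n; rewrite /normalized_derivative scaler_eq0 negb_or c0 (derivn_neq0 sQ).
have nd1 i : (i <= n)%N -> roots_in_unit_interval (normalized_derivative Q n i).
  move=> i_n z; rewrite /normalized_derivative rootZ//.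
  exact: (derivn_roots_in_unit_interval sQ i_n Q1).
split; last by apply: real_zeros_itv; [exact: nd0|exact: nd1].
set P := \prod_(_ <- _) _; set q := \prod_(_ <- _) _.
have := real_zerosE (nd0 0%N isT) (nd1 0%N isT); rewrite -/P => E0.
have := real_zerosE (nd0 j jn) (nd1 j jn); rewrite -/q => Ej.
have [a aE] : exists a, map_poly toC P^`(j) = a *: map_poly toC q.
  have l0 : lead_coef (normalized_derivative Q n 0) != 0 by rewrite lead_coef_eq0 nd0.
  have PE : map_poly toC P = (lead_coef (normalized_derivative Q n 0))^-1 *:
      normalized_derivative Q n 0.
    by rewrite [in X in _ *: X]E0 scalerA mulVf// scale1r.
  have QE : (Q n)^`(j) = ((n - j)`!%:R / n`!%:R)^-1 *: normalized_derivative Q n j.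
    by rewrite /normalized_derivative scalerA mulVf// scale1r.
  rewrite -derivn_map PE derivnZ /normalized_derivative derivnZ derivn0 QE Ej !scalerA.
  by eexists.
have qmonic : q \is monic by exact: monic_prod_XsubC.
have aE' : a = toC (lead_coef P^`(j)).
  rewrite -lead_coef_map aE lead_coefZ lead_coef_map (monicP qmonic).
  by rewrite rmorph1 mulr1.
apply: (map_poly_inj toC); rewrite aE aE'.
by rewrite -[in RHS]mul_polyC rmorphM/= map_polyC/= mul_polyC.
Qed.

End Zeros.

(** * From moments to weak convergence *)

Section WeakConvergence.
Variable R : realType.
Implicit Types (f : R -> R) (s : seq R).

Local Notation D := (`[-1, 1]%classic : set (measurableTypeR R)).

Lemma continuous_measurable_itv f : {within `[-1, 1], continuous f} ->
  measurable_fun D f.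
Proof. by move=> fc; apply: subspace_continuous_measurable_fun. Qed.

Lemma Rintegral_zero_counting n (p : {poly R[i]}) f :
  p != 0 -> roots_in_unit_interval p -> {within `[-1, 1], continuous f} ->
  \int[zero_counting n p]_(x in `[-1, 1]) f x =
  n%:R^-1 * \sum_(x <- real_zeros p) f x.
Proof.
move=> p0 p1 /continuous_measurable_itv mf.
have ge0_zc (g : R -> R) : (forall x, 0 <= g x) -> measurable_fun D g ->
    (\int[zero_counting n p]_(x in D) (g x)%:E =
    (n%:R^-1 * \sum_(x <- real_zeros p) g x)%:E)%E.
  move=> g0 mg; have mEg : measurable_fun D (EFin \o g) by exact/measurable_EFinP.
  rewrite ge0_integral_mscale//=; last by move=> x _; rewrite lee_fin.
  rewrite ge0_integral_measure_sum//; last by move=> x _; rewrite lee_fin.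
  rewrite EFinM; congr (_ * _)%E.
  rewrite /real_zeros big_map (big_nth 0) big_mkord -sumEFin.
  apply: eq_bigr => i _; rewrite integral_dirac// diracE mem_set ?mul1e//=.
  apply: (real_zeros_itv p0 p1); apply: map_f; exact: mem_nth.
rewrite /Rintegral integralE.
have -> : (fun x => (f x)%:E)^\+%E = EFin \o f^\+ by exact: funerpos.
have -> : (fun x => (f x)%:E)^\-%E = EFin \o f^\- by exact: funerneg.
rewrite !ge0_zc; last 4 first.
- exact: funrneg_ge0.
- exact: measurable_funrneg.
- exact: funrpos_ge0.
- exact: measurable_funrpos.
rewrite -EFinB /= -mulrBr -sumrB; congr (_ * _).
by apply: eq_bigr => x _; rewrite -[in RHS](funrposBneg f).
Qed.

Variable mu : {measure set (measurableTypeR R) -> \bar R}.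
Hypothesis mufin : (mu D < +oo)%E.

Lemma continuous_integrable f : {within `[-1, 1], continuous f} ->
  mu.-integrable D (EFin \o f).
Proof.
move=> fc; apply: measurable_bounded_integrable => //.
  exact: continuous_measurable_itv.
have [M M0 fM] := segment_bounded fc.
exists M; split; first exact: num_real.
by move=> y My x x1 /=; rewrite (le_trans (fM x x1))// ltW.
Qed.

Lemma continuous_within_unit f : continuous f -> {within `[-1, 1], continuous f}.
Proof. exact: continuous_subspaceT. Qed.

Lemma Rintegral_horner (p : {poly R}) :
  \int[mu]_(x in `[-1, 1]) p.[x] =
  \sum_(i < size p) p`_i * \int[mu]_(x in `[-1, 1]) x ^+ i.
Proof.
under eq_Rintegral do rewrite horner_coef.
have cX i : continuous (fun x : R => x ^+ i) by exact: exprn_continuous.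
elim: (size p) => [|n IH].
  by rewrite big_ord0; under eq_Rintegral do rewrite big_ord0; rewrite Rintegral_cst ?mul0r.
rewrite big_ord_recr /= -IH -RintegralZl//; last first.
  by apply: continuous_integrable; apply: continuous_within_unit; exact: cX.
rewrite -RintegralD//.
- by apply: eq_Rintegral => x _; rewrite big_ord_recr.
- apply: continuous_integrable; apply: continuous_within_unit => x.
  apply: cvg_big => [|i _]; first exact: add_continuous.
  by apply: cvgM; [exact: cvg_cst|exact: cX].
- apply: continuous_integrable; apply: continuous_within_unit => x.
  by apply: cvgM; [exact: cvg_cst|exact: cX].
Qed.

(** Replacing [f] by a polynomial costs at most [d] times the total masses, which are
    at most 1 for the averages and [fine (mu D)] for the limit. *)
Lemma moments_weak_cvg (xs : nat -> seq R) f :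
  (\forall n \near \oo, (size (xs n) <= n)%N /\ {in xs n, forall x, x \in `[-1, 1]}) ->
  (forall i, (\sum_(x <- xs n) x ^+ i) / n%:R @[n --> \oo] -->
    \int[mu]_(x in `[-1, 1]) x ^+ i) ->
  {within `[-1, 1], continuous f} ->
  (\sum_(x <- xs n) f x) / n%:R @[n --> \oo] --> \int[mu]_(x in `[-1, 1]) f x.
Proof.
move=> xs1 xsM fc.
pose m := fine (mu D).
have m0 : 0 <= m by exact: fine_ge0.
apply/cvgrPdist_le => e e0.
pose d := e / (m + 2).
have d0 : 0 < d by rewrite divr_gt0// ltr_wpDl.
have [p fp] := weierstrass fc d0.
have pc : {within `[-1, 1], continuous (fun x => p.[x])}.
  by apply: continuous_within_unit; exact: continuous_horner.
have muB : `|\int[mu]_(x in `[-1, 1]) f x - \int[mu]_(x in `[-1, 1]) p.[x]| <= d * m.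
  have ifp : mu.-integrable D (EFin \o (fun x => f x - p.[x])).
    apply: continuous_integrable => x; apply: cvgB; [exact: fc|exact: pc].
  rewrite -RintegralB//; try exact: continuous_integrable.
  rewrite (le_trans (le_normr_Rintegral _ _))// -Rintegral_cst//.
  apply: le_Rintegral => //.
  - apply: continuous_integrable => x; apply: cvg_norm.
    by apply: cvgB; [exact: fc|exact: pc].
  - by apply: continuous_integrable => x; exact: cvg_cst.
have pcvg : (\sum_(x <- xs n) p.[x]) / n%:R @[n --> \oo] -->
    \int[mu]_(x in `[-1, 1]) p.[x].
  rewrite Rintegral_horner.
  have -> : (fun n => (\sum_(x <- xs n) p.[x]) / n%:R) =
      (fun n => \sum_(i < size p) p`_i * ((\sum_(x <- xs n) x ^+ i) / n%:R)).
    apply/funext => n.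
    under eq_bigr do rewrite horner_coef.
    rewrite exchange_big mulr_suml; apply: eq_bigr => i _.
    by rewrite -mulr_sumr mulrA.
  apply: cvg_big => [|i _]; first exact: add_continuous.
  by apply: cvgM; [exact: cvg_cst|exact: xsM].
near=> n.
have n0 : 0 < n%:R :> R by rewrite ltr0n; near: n; exists 1%N.
have [sn sx] : (size (xs n) <= n)%N /\ {in xs n, forall x, x \in `[-1, 1]}.
  by near: n.
have xsB : `|(\sum_(x <- xs n) f x) / n%:R - (\sum_(x <- xs n) p.[x]) / n%:R| <= d.
  rewrite -mulrBl -sumrB normrM normfV [`|n%:R|]gtr0_norm// ler_pdivrMr//.
  rewrite (le_trans (ler_norm_sum _ _ _))//.
  rewrite (@le_trans _ _ (\sum_(x <- xs n) d))//.
    by rewrite big_seq [leRHS]big_seq ler_sum// => x /sx /fp.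
  rewrite big_const_seq count_predT iter_addr_0 -[d *+ _]mulr_natr ler_wpM2l ?ler_nat//.
  exact: ltW.
have pB : `|\int[mu]_(x in `[-1, 1]) p.[x] - (\sum_(x <- xs n) p.[x]) / n%:R| <= d.
  by near: n; move/cvgrPdist_le: pcvg; exact.
have eE : e = d * m + d + d.
  rewrite /d; field; rewrite gt_eqF// ltr_wpDl//.
move: muB xsB pB; set If := Rintegral _ _ _; set Ip := Rintegral _ _ _.
set Sf := _ / _; set Sp := _ / _ => muB xsB pB.
rewrite eE.
have -> : If - Sf = (If - Ip) + (Ip - Sp) - (Sf - Sp) by ring.
rewrite (le_trans (ler_normB _ _))// lerD// (le_trans (ler_normD _ _))//.
by rewrite lerD.
Unshelve. all: by end_near. Qed.

End WeakConvergence.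

(** * Integrals against a density *)

Section Density.
Variables (R : realType) (rho : R -> R).
Hypotheses (rho0 : forall x, 0 <= rho x) (mrho : measurable_fun setT rho).

Local Notation nu := (density_measure rho0 mrho).
Local Notation leb := (@lebesgue_measure R).

Lemma density_dominated : nu `<< leb.
Proof.
apply/null_content_dominatesP => A mA A0.
rewrite /density_measure; apply: null_set_integral => //.
by apply/measurable_EFinP; exact: measurable_funTS.
Qed.

Hypothesis nufin : (nu setT < +oo)%E.

Let nu_fin_num : fin_num_fun nu.
Proof.
move=> A mA; rewrite ge0_fin_numE//; apply: le_lt_trans nufin.
by apply: le_measure => //; rewrite inE.
Qed.

HB.instance Definition _ :=
  @Measure_isFinite.Build _ _ _ nu nu_fin_num.

Lemma density_integrable : leb.-integrable setT (EFin \o rho).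
Proof.
apply/integrableP; split; first exact/measurable_EFinP.
apply: le_lt_trans nufin; rewrite le_eqVlt; apply/orP; left; apply/eqP.
by apply: eq_integral => x _ /=; rewrite ger0_norm.
Qed.

(** The density is a version of the Radon-Nikodym derivative. *)
Lemma density_Rintegral (D : set R) f : measurable D ->
  nu.-integrable D (EFin \o f) ->
  \int[nu]_(x in D) f x = \int[leb]_(x in D) (f x * rho x).
Proof.
move=> mD fi; rewrite /Rintegral; congr fine.
have dom := density_dominated.
rewrite -(Radon_Nikodym_change_of_variables dom mD fi).
have mf : measurable_fun D (EFin \o f) by exact: measurable_int fi.
have irn : leb.-integrable setT (Radon_Nikodym (charge_of_finite_measure nu) leb).
  exact: Radon_Nikodym_integrable.
have rnE : ae_eq leb D (Radon_Nikodym (charge_of_finite_measure nu) leb) (EFin \o rho).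
  apply: integral_ae_eq => //.
  - exact: (integrableS measurableT).
  - by apply/measurable_EFinP; exact: measurable_funTS.
  - by move=> E _ mE; rewrite -Radon_Nikodym_integral.
apply: ae_eq_integral => //.
- apply: emeasurable_funM => //; apply: measurable_funTS.
  exact: measurable_int irn.
- by apply/measurable_EFinP; apply: measurable_funM;
    [exact/measurable_EFinP|exact: measurable_funTS].
- by move: rnE; apply: filterS => x /= rnE Dx; rewrite rnE.
Qed.

End Density.

Section OddIntegral.
Variable R : realType.
Local Notation leb := (@lebesgue_measure R).
Local Notation D := (`[-1, 1]%classic : set (measurableTypeR R)).

Lemma Rintegral_odd (h : R -> R) : measurable_fun setT h ->
  leb.-integrable D (EFin \o h) -> (forall x, h (- x) = - h x) ->
  \int[leb]_(x in D) h x = 0.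
Proof.
move=> mh ih hN.
pose N : measurableTypeR R -> measurableTypeR R := -%R.
have mN : measurable_fun setT N by exact: oppr_measurable.
have preE : N @^-1` D = D by rewrite /N opp_preimage_itvbndbnd/= opprK.
have ihN : leb.-integrable D (EFin \o (fun x => h (- x))).
  have -> : EFin \o (fun x => h (- x)) = (fun x => - (EFin \o h) x)%E.
    by apply/funext => x; rewrite /= hN.
  exact: integrableN.
have E : \int[leb]_(x in D) h x = \int[leb]_(x in D) h (- x).
  rewrite /Rintegral; congr fine.
  transitivity (\int[pushforward leb N]_(x in D) (h x)%:E)%E.
    by apply: eq_measure_integral => A mA _; rewrite [RHS]lebesgue_measureN.
  rewrite (integral_pushforward mN)//= ?preE//.
  exact/measurable_EFinP.
have {}E : \int[leb]_(x in D) h x = - \int[leb]_(x in D) h x.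
  transitivity (\int[leb]_(x in D) (-1 * h x)).
    by rewrite E; apply: eq_Rintegral => x _; rewrite hN mulN1r.
  by rewrite RintegralZl// mulN1r.
by move: E; clear; move: (Rintegral _ _ _) => I E; lra.
Qed.

End OddIntegral.

(** * Integrals of the semicircle and of the limit density *)

Section Halfcircle.
Variable R : realType.
Implicit Types (f g F : R -> R) (a b x : R).

Local Notation leb := (@lebesgue_measure R).

Lemma Rintegral_FTC a b f F : a < b -> {within `[a, b], continuous f} ->
  (forall x, x \in `[a, b] -> {for x, continuous F}) ->
  {in `]a, b[, forall x, is_derive x 1 F (f x)} ->
  \int[leb]_(x in `[a, b]) f x = F b - F a.
Proof.
move=> ab fc Fc dF; rewrite /Rintegral (@continuous_FTC2 _ f F)//.
  split.
  - by move=> x xab; have [] := dF x xab.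
  - by apply: cvg_at_right_filter; apply: Fc; rewrite in_itv/= lexx ltW.
  - by apply: cvg_at_left_filter; apply: Fc; rewrite in_itv/= lexx ltW.
by move=> x xab; rewrite derive1E; have dFx := dF x xab; exact: derive_val.
Qed.

Lemma is_derive_mul x f g a b : is_derive x 1 f a -> is_derive x 1 g b ->
  is_derive x 1 (fun y => f y * g y) (a * g x + f x * b).
Proof.
move=> df dg; apply: is_derive_eq (is_deriveM df dg) _.
by rewrite /GRing.scale/=; ring.
Qed.

Lemma is_derive_add x f g a b : is_derive x 1 f a -> is_derive x 1 g b ->
  is_derive x 1 (fun y => f y + g y) (a + b).
Proof. exact: is_deriveD. Qed.

Lemma is_derive_inv x g b : g x != 0 -> is_derive x 1 g b ->
  is_derive x 1 (fun y => (g y)^-1) (- b / g x ^+ 2).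
Proof.
move=> g0 dg; apply: is_derive_eq (is_deriveV g0 dg) _.
by rewrite /GRing.scale/= mulrC mulNr mulrN.
Qed.

Lemma is_derive_pow n x : is_derive x 1 (fun y => y ^+ n.+1) (n.+1%:R * x ^+ n).
Proof.
by apply: DeriveDef; [exact: exprn_derivable|rewrite exp_derive /GRing.scale/= mulr1].
Qed.

Definition halfcircle (s : R) x := Num.sqrt (s ^+ 2 - x ^+ 2).

Lemma halfcircle_continuous s : continuous (halfcircle s).
Proof.
move=> x; apply: (@cvg_comp _ _ _ (fun y => s ^+ 2 - y ^+ 2) (@Num.sqrt R) _
  (nbhs (s ^+ 2 - x ^+ 2))).
  by apply: cvgB; [exact: cvg_cst|exact: exprn_continuous].
exact: sqrt_continuous.
Qed.

Variable s : R.
Hypothesis s0 : 0 < s.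
Local Notation r := (halfcircle s).

Lemma halfcircle_gt0 x : x \in `]- s, s[ -> 0 < r x.
Proof.
rewrite in_itv/= -ltr_norml => xs; rewrite sqrtr_gt0 subr_gt0.
by rewrite -(real_normK (num_real x)) ltrXn2r// gtr0_norm.
Qed.

Lemma sqr_halfcircle x : x \in `[- s, s] -> r x ^+ 2 = s ^+ 2 - x ^+ 2.
Proof.
rewrite in_itv/= -ler_norml => xs; rewrite sqr_sqrtr// subr_ge0.
by rewrite -(real_normK (num_real x)) lerXn2r ?nnegrE// ltW.
Qed.

Lemma halfcircle_end : r s = 0 /\ r (- s) = 0.
Proof. by rewrite /halfcircle sqrrN subrr sqrtr0. Qed.

Lemma is_derive_halfcircle x : x \in `]- s, s[ -> is_derive x 1 r (- x / r x).
Proof.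
move=> xs; have r0 := halfcircle_gt0 xs.
have d0 : 0 < s ^+ 2 - x ^+ 2 by rewrite -sqrtr_gt0.
have dg : is_derive x 1 (fun y => s ^+ 2 - y ^+ 2) (- (2 * x)).
  have := is_derive_add (is_derive_cst (s ^+ 2) x 1)
    (is_derive_mul (is_derive_cst (- 1 : R) x 1) (is_derive_pow 1 x)).
  have -> : (fun y => cst (s ^+ 2) y + cst (-1) y * y ^+ 2) = (fun y => s ^+ 2 - y ^+ 2).
    by apply/funext => y; rewrite /cst mulN1r.
  by move=> H; apply: is_derive_eq H _; rewrite /cst expr1; ring.
apply: is_derive_eq (@is_derive1_comp _ (@Num.sqrt R)
  (fun y => s ^+ 2 - y ^+ 2) _ _ _ (is_derive1_sqrt d0) dg) _.
by rewrite -/(r x); field; rewrite gt_eqF.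
Qed.

End Halfcircle.

Section SemicircleIntegrals.
Variables (R : realType) (s : R).
Hypothesis s0 : 0 < s.
Implicit Types x : R.

Local Notation leb := (@lebesgue_measure R).
Local Notation r := (halfcircle s).

Definition semicircle_moment c := \int[leb]_(x in `[- s, s]) (x ^+ c * r x).

Let Ns_lt_s : - s < s.
Proof. by rewrite -subr_gt0 opprK addr_gt0. Qed.

Let oo_cc x : x \in `]- s, s[ -> x \in `[- s, s].
Proof. by rewrite !in_itv/= => /andP[/ltW -> /ltW ->]. Qed.

Let r_cont := @halfcircle_continuous R s.

(** The primitive is [y ^ (c + 1) * (s ^ 2 - y ^ 2) ^ (3 / 2)], which vanishes at
    both ends. *)
Lemma semicircle_momentSS c : c.+4%:R * semicircle_moment c.+2 =
  s ^+ 2 * c.+1%:R * semicircle_moment c.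
Proof.
have ic (k : nat) : leb.-integrable `[- s, s] (EFin \o (fun x => x ^+ k * r x)).
  apply: continuous_compact_integrable; first exact: segment_compact.
  apply: continuous_subspaceT => x.
  by apply: cvgM; [exact: exprn_continuous|exact: r_cont].
pose f x := s ^+ 2 * c.+1%:R * (x ^+ c * r x) - c.+4%:R * (x ^+ c.+2 * r x).
have : \int[leb]_(x in `[- s, s]) f x = 0.
  rewrite (Rintegral_FTC (F := fun x => x ^+ c.+1 * (r x * r x * r x)))//.
  - by rewrite (halfcircle_end s).1 (halfcircle_end s).2 !mulr0 subrr.
  - apply: continuous_subspaceT => x; apply: cvgB; apply: cvgM;
      by [exact: cvg_cst|apply: cvgM; [exact: exprn_continuous|exact: r_cont]].
  - move=> x _; apply: cvgM; first exact: exprn_continuous.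
    by apply: cvgM; [apply: cvgM|]; exact: r_cont.
  - move=> x xs; have r0 := halfcircle_gt0 xs; have r2 := sqr_halfcircle s0 (oo_cc xs).
    have dr := is_derive_halfcircle xs.
    apply: is_derive_eq (is_derive_mul (is_derive_pow c x)
      (is_derive_mul (is_derive_mul dr dr) dr)) _.
    rewrite /f !exprS; move: (x ^+ c) => u.
    have -> : (- x / r x * r x + r x * (- x / r x)) * r x + r x * r x * (- x / r x) =
      - 3 * x * r x by field; rewrite gt_eqF.
    have -> : c.+1%:R * u * (r x * r x * r x) = c.+1%:R * u * (r x ^+ 2 * r x) by ring.
    by rewrite r2 -![_.+4%:R]natr1 -[c.+3%:R]natr1 -[c.+2%:R]natr1; ring.
have mZ (k : nat) (a : R) : leb.-integrable `[- s, s] (EFin \o (fun x => a * (x ^+ k * r x))).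
  apply: continuous_compact_integrable; first exact: segment_compact.
  apply: continuous_subspaceT => x.
  by apply: cvgM; [exact: cvg_cst|apply: cvgM; [exact: exprn_continuous|exact: r_cont]].
by rewrite RintegralB// !RintegralZl// => /eqP; rewrite subr_eq0 => /eqP ->.
Qed.

Let phi x := atan (x / (s + r x)).

Let sr_gt0 x : 0 < s + r x.
Proof. by rewrite ltr_wpDr// sqrtr_ge0. Qed.

Let phi_cont x : {for x, continuous phi}.
Proof.
apply: (@cvg_comp _ _ _ (fun y => y / (s + r y)) (@atan R) _
  (nbhs (x / (s + r x)))); last exact: continuous_atan.
apply: cvgM; first exact: cvg_id.
apply: cvgV; first by rewrite gt_eqF.
by apply: cvgD; [exact: cvg_cst|exact: r_cont].
Qed.

(** [2 * phi] is the polar angle [asin (x / s)], in a form that is smooth up to the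
    ends of the interval. *)
Let is_derive_phi x : x \in `]- s, s[ -> is_derive x 1 phi (2 * r x)^-1.
Proof.
move=> xs; have r0 := halfcircle_gt0 xs; have r2 := sqr_halfcircle s0 (oo_cc xs).
have sr := sr_gt0 x.
have dr := is_derive_halfcircle xs.
have dd : is_derive x 1 (fun y => s + r y) (- x / r x).
  by apply: is_derive_eq (is_derive_add (is_derive_cst s x 1) dr) _; rewrite add0r.
have dq := is_derive_mul (is_derive_id x 1) (@is_derive_inv R x (fun y => s + r y) _ (lt0r_neq0 sr) dd).
apply: is_derive_eq (@is_derive1_comp _ (@atan R) (fun y => y / (s + r y)) _ _ _
  (is_derive1_atan _) dq) _.
have x2 : x ^+ 2 = s ^+ 2 - r x ^+ 2 by rewrite r2; ring.
have -> : 1 + (x / (s + r x)) ^+ 2 = 2 * s / (s + r x).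
  by rewrite expr_div_n x2; field; rewrite gt_eqF.
have -> : 1 / (s + r x) + x * (- (- x / r x) / (s + r x) ^+ 2) = s / (r x * (s + r x)).
  transitivity ((r x * (s + r x) + x ^+ 2) / (r x * (s + r x) ^+ 2)).
    by field; rewrite !gt_eqF.
  by rewrite x2; field; rewrite !gt_eqF.
by field; rewrite !gt_eqF.
Qed.

Let phi_end : phi s = pi / 4 /\ phi (- s) = - (pi / 4).
Proof.
rewrite /phi (halfcircle_end s).1 (halfcircle_end s).2 addr0 mulNr atanN divff ?gt_eqF//.
by rewrite atan1.
Qed.

Lemma semicircle_moment0 : semicircle_moment 0 = pi * s ^+ 2 / 2.
Proof.
rewrite /semicircle_moment.
pose F x := x * r x / 2 + s ^+ 2 * phi x.
rewrite (Rintegral_FTC (F := F))//.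
- by rewrite /F (halfcircle_end s).1 (halfcircle_end s).2 phi_end.1 phi_end.2; field.
- apply: continuous_subspaceT => x; apply: cvgM; first exact: exprn_continuous.
  exact: r_cont.
- move=> x _; apply: cvgD.
    apply: cvgM; last exact: cvg_cst.
    by apply: cvgM; [exact: cvg_id|exact: r_cont].
  by apply: cvgM; [exact: cvg_cst|exact: phi_cont].
- move=> x xs; have r0 := halfcircle_gt0 xs; have r2 := sqr_halfcircle s0 (oo_cc xs).
  have dr := is_derive_halfcircle xs.
  have dF := is_derive_add (is_derive_mul (is_derive_mul (is_derive_id x 1) dr)
    (is_derive_cst (2^-1 : R) x 1)) (is_derive_mul (is_derive_cst (s ^+ 2) x 1) (is_derive_phi xs)).
  rewrite (_ : (fun y => _) = F) in dF; last exact/funext.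
  apply: is_derive_eq dF _.
  rewrite /cst expr0 mul1r.
  have s2 : s ^+ 2 = r x ^+ 2 + x ^+ 2 by rewrite r2; ring.
  by rewrite s2; field; rewrite gt_eqF.
Qed.

Variable t : R.
Hypotheses (t0 : 0 < t) (st : s ^+ 2 = 1 - t ^+ 2).

Let q x := Num.sqrt (1 - x ^+ 2).
Let psi x := atan (t * x / (s * q x + r x)).

Let oneB_gt0 x : x \in `[- s, s] -> 0 < 1 - x ^+ 2.
Proof.
move=> /(sqr_halfcircle s0) r2; have : 0 <= s ^+ 2 - x ^+ 2 by rewrite -r2 sqr_ge0.
by have := exprn_gt0 2 t0; have := st; lra.
Qed.

Let q_gt0 x : x \in `[- s, s] -> 0 < q x.
Proof. by move=> /oneB_gt0; rewrite sqrtr_gt0. Qed.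

Let q_cont : continuous q.
Proof.
have -> : q = halfcircle 1 by apply/funext => x; rewrite /q /halfcircle expr1n.
exact: halfcircle_continuous.
Qed.

Let sqr_gt0' x : x \in `[- s, s] -> 0 < s * q x + r x.
Proof. by move=> /q_gt0 q0; rewrite ltr_wpDr ?sqrtr_ge0// mulr_gt0. Qed.

Let psi_cont x : x \in `[- s, s] -> {for x, continuous psi}.
Proof.
move=> xs.
apply: (@cvg_comp _ _ _ (fun y => t * y / (s * q y + r y)) (@atan R) _
  (nbhs (t * x / (s * q x + r x)))); last exact: continuous_atan.
apply: cvgM; first by apply: cvgM; [exact: cvg_cst|exact: cvg_id].
apply: cvgV; first by rewrite gt_eqF// sqr_gt0'.
by apply: cvgD; [apply: cvgM; [exact: cvg_cst|exact: q_cont]|exact: r_cont].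
Qed.

Let is_derive_q x : x \in `]- s, s[ -> is_derive x 1 q (- x / q x).
Proof.
move=> xs; have q0 := q_gt0 (oo_cc xs).
have qE : q = halfcircle 1.
  by apply/funext => y; rewrite /q /halfcircle expr1n.
rewrite qE; apply: is_derive_halfcircle => //.
have := oneB_gt0 (oo_cc xs); rewrite subr_gt0 in_itv/= -ltr_norml.
by rewrite -(real_normK (num_real x)) expr_lt1.
Qed.

(** [2 * psi] is [asin (t x / (s q))]. *)
Let is_derive_psi x : x \in `]- s, s[ ->
  is_derive x 1 psi (t / (2 * (1 - x ^+ 2) * r x)).
Proof.
move=> xs; have xs' := oo_cc xs.
have r0 := halfcircle_gt0 xs; have r2 := sqr_halfcircle s0 xs'.
have q0 := q_gt0 xs'; have q2 : q x ^+ 2 = 1 - x ^+ 2.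
  by rewrite sqr_sqrtr// ltW// oneB_gt0.
have sr := sqr_gt0' xs'.
have dd : is_derive x 1 (fun y => s * q y + r y) (s * (- x / q x) + (- x / r x)).
  apply: is_derive_eq (is_derive_add (is_derive_mul (is_derive_cst s x 1) (is_derive_q xs))
    (is_derive_halfcircle xs)) _.
  by rewrite mul0r add0r.
have dq := is_derive_mul (is_derive_mul (is_derive_cst t x 1) (is_derive_id x 1))
  (@is_derive_inv R x (fun y => s * q y + r y) _ (lt0r_neq0 sr) dd).
apply: is_derive_eq (@is_derive1_comp _ (@atan R)
  (fun y => t * y / (s * q y + r y)) _ _ _ (is_derive1_atan _) dq) _.
rewrite /cst mul0r add0r mulr1 -q2.
have x2 : x ^+ 2 = 1 - q x ^+ 2 by rewrite q2; ring.
have t2 : t ^+ 2 = 1 - s ^+ 2 by rewrite st; ring.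
have rr2 : r x ^+ 2 = s ^+ 2 - 1 + q x ^+ 2 by rewrite r2 x2; ring.
have -> : 1 + (t * x / (s * q x + r x)) ^+ 2 = 2 * s * q x / (s * q x + r x).
  transitivity (((s * q x + r x) ^+ 2 + t ^+ 2 * x ^+ 2) / (s * q x + r x) ^+ 2).
    by field; rewrite gt_eqF.
  transitivity (2 * s * q x * (s * q x + r x) / (s * q x + r x) ^+ 2); last first.
    by field; rewrite gt_eqF.
  congr (_ / _); rewrite t2 x2.
  transitivity (s ^+ 2 * q x ^+ 2 + 2 * s * q x * r x + r x ^+ 2 + (1 - s ^+ 2) * (1 - q x ^+ 2)).
    by ring.
  by rewrite rr2; ring.
have -> : t / (s * q x + r x) +
    t * x * (- (s * (- x / q x) + - x / r x) / (s * q x + r x) ^+ 2) =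
    t * s / (q x * r x * (s * q x + r x)).
  transitivity (t * (r x * q x * (s * q x + r x) + x ^+ 2 * (s * r x + q x))
     / (q x * r x * (s * q x + r x) ^+ 2)).
    by field; rewrite !gt_eqF.
  transitivity (t * (s * (r x + s * q x)) / (q x * r x * (s * q x + r x) ^+ 2)); last first.
    by field; rewrite !gt_eqF.
  congr (t * _ / _); rewrite x2.
  transitivity (s * r x * q x ^+ 2 + q x * r x ^+ 2 + (1 - q x ^+ 2) * (s * r x + q x)).
    by ring.
  by rewrite rr2; ring.
by field; rewrite !gt_eqF.
Qed.

(** The primitive is [2 * phi - 2 * t * psi], that is,
    [asin (x / s) - t * asin (t * x / (s * q))]. *)
Lemma Rintegral_halfcircle_div :
  \int[leb]_(x in `[- s, s]) (r x / (1 - x ^+ 2)) = pi * (1 - t).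
Proof.
pose F x := 2 * phi x - 2 * t * psi x.
rewrite (Rintegral_FTC (F := F))//.
- have qs : q s = t by rewrite /q st subKr sqrtr_sqr gtr0_norm.
  have qNs : q (- s) = t by rewrite /q sqrrN; exact: qs.
  have st0 : s * t != 0 by rewrite mulf_neq0// gt_eqF.
  have psis : psi s = pi / 4.
    by rewrite /psi qs (halfcircle_end s).1 addr0 [t * s]mulrC divff// atan1.
  have psiNs : psi (- s) = - (pi / 4).
    by rewrite /psi qNs (halfcircle_end s).2 addr0 mulrN mulNr atanN [t * s]mulrC divff// atan1.
  by rewrite /F psis psiNs phi_end.1 phi_end.2; field.
- apply/subspace_continuousP => x xs; apply: cvg_within_filter.
  apply: cvgM; first exact: r_cont.
  apply: cvgV; first by rewrite gt_eqF// oneB_gt0.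
  by apply: cvgB; [exact: cvg_cst|exact: exprn_continuous].
- move=> x xs; apply: cvgB; apply: cvgM; do ?exact: cvg_cst.
    exact: phi_cont.
  exact: psi_cont.
- move=> x xs; have r0 := halfcircle_gt0 xs; have r2 := sqr_halfcircle s0 (oo_cc xs).
  have x1 := oneB_gt0 (oo_cc xs).
  have := is_derive_add (is_derive_mul (is_derive_cst (2 : R) x 1) (is_derive_phi xs))
    (is_derive_mul (is_derive_cst (- (2 * t)) x 1) (is_derive_psi xs)).
  have -> : (fun y => cst 2 y * phi y + cst (- (2 * t)) y * psi y) = F.
    by apply/funext => y; rewrite /F /cst; ring.
  move=> dF; apply: is_derive_eq dF _; rewrite /cst.
  transitivity ((1 - x ^+ 2 - t ^+ 2) / ((1 - x ^+ 2) * r x)).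
    by field; rewrite !gt_eqF.
  have -> : 1 - x ^+ 2 - t ^+ 2 = r x ^+ 2 by rewrite r2 st; ring.
  by field; rewrite !gt_eqF.
Qed.

End SemicircleIntegrals.

(** * Moments of the limit measure *)

Section LimitMeasureMoments.
Variables (R : realType) (t : R).
Hypothesis t01 : 0 <= t < 1.
Implicit Types (x : R) (c : nat).

Local Notation leb := (@lebesgue_measure R).
Local Notation D := (`[-1, 1]%classic : set (measurableTypeR R)).
Local Notation nu := (mu_measure t).
Local Notation rho := (mu_density t).

Let s := Num.sqrt (1 - t ^+ 2).

Let oneB_gt0 : 0 < 1 - t ^+ 2.
Proof. by case/andP: t01 => t0 t1; rewrite subr_gt0 expr_lt1. Qed.

Let s_gt0 : 0 < s. Proof. by rewrite sqrtr_gt0. Qed.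

Let sqr_s : s ^+ 2 = 1 - t ^+ 2. Proof. by rewrite sqr_sqrtr// ltW. Qed.

Let s_le1 : s <= 1.
Proof. by rewrite -[leRHS]sqrtr1 ler_wsqrtr// gerBl sqr_ge0. Qed.

Let subD : `[- s, s] `<=` D.
Proof. by apply: subset_itv; rewrite bnd_simp ?lerN2. Qed.

Let rhoE x : rho x =
  if x \in `[- s, s] then pi^-1 * (halfcircle s x / (1 - x ^+ 2)) else 0.
Proof. by rewrite /mu_density patchE /halfcircle sqr_s mem_setE. Qed.

Let halfcircle_out x : x \notin `[- s, s] -> halfcircle s x = 0.
Proof.
rewrite in_itv/= -ler_norml -ltNge => sx; apply/eqP; rewrite sqrtr_eq0 subr_le0.
by rewrite -[leRHS](real_normK (num_real x)) lerXn2r ?nnegrE// ltW.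
Qed.

Let rho_out x : x \notin D -> rho x = 0.
Proof.
move=> xD; rewrite rhoE ifF//; apply: contraNF xD => xs.
by rewrite inE; exact: subD.
Qed.

Let rho_weight x : (1 - x ^+ 2) * rho x = pi^-1 * halfcircle s x.
Proof.
rewrite rhoE; case: ifPn => [xs|/halfcircle_out ->]; last by rewrite !mulr0.
have [x1|x1] := eqVneq (1 - x ^+ 2) 0.
  rewrite x1 mul0r; suff -> : halfcircle s x = 0 by rewrite mulr0.
  apply/eqP; rewrite sqrtr_eq0 subr_le0 sqr_s; move/eqP: x1.
  by rewrite subr_eq0 => /eqP <-; rewrite gerBl sqr_ge0.
by rewrite mulrCA; congr (_ * _); rewrite mulrC divfK.
Qed.

Let halfcircleN x : halfcircle s (- x) = halfcircle s x.
Proof. by rewrite /halfcircle sqrrN. Qed.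

Let rhoN x : rho (- x) = rho x.
Proof. by rewrite !rhoE halfcircleN sqrrN !in_itv/= lerN2 lerNl andbC. Qed.

Lemma mu_measure_setT : nu setT = nu D.
Proof.
rewrite /mu_measure /= /density_measure [RHS]integral_mkcond.
apply: eq_integral => x _; rewrite patchE; case: ifPn => // xD.
by rewrite rho_out.
Qed.

Lemma mu_measure_mass : 0 < t -> nu D = (1 - t)%:E.
Proof.
move=> t0; pose g x := halfcircle s x / (1 - x ^+ 2).
have gi : leb.-integrable `[- s, s] (EFin \o g).
  apply: continuous_compact_integrable; first exact: segment_compact.
  apply/subspace_continuousP => x xs; apply: cvg_within_filter.
  apply: cvgM; first exact: halfcircle_continuous.
  apply: cvgV; last by apply: cvgB; [exact: cvg_cst|exact: exprn_continuous].
  have := sqr_halfcircle s_gt0 xs; have := sqr_ge0 (halfcircle s x).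
  rewrite sqr_s => h0 h; have -> : 1 - x ^+ 2 = halfcircle s x ^+ 2 + t ^+ 2.
    by rewrite h; ring.
  by rewrite gt_eqF// ltr_wpDl// exprn_gt0.
pose S : set (measurableTypeR R) := `[- s, s]%classic.
have -> : nu D = (\int[leb]_(x in S) (pi^-1 * g x)%:E)%E.
  rewrite /mu_measure /= /density_measure [LHS]integral_mkcond [RHS]integral_mkcond.
  apply: eq_integral => x _; rewrite !patchE rhoE !mem_setE.
  case: ifPn => xD; case: ifPn => xs //.
  by exfalso; move/negP: xD; apply; exact: subD.
have gE : (\int[leb]_(x in S) (g x)%:E = (pi * (1 - t))%:E)%E.
  rewrite -(Rintegral_halfcircle_div s_gt0 t0 sqr_s) /Rintegral fineK//.
  exact: (integrable_fin_num _ gi).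
transitivity (pi^-1%:E * \int[leb]_(x in S) (g x)%:E)%E.
  have mS : measurable S by exact: measurable_itv.
  by rewrite -(integralZl mS gi); exact: eq_integral.
rewrite gE -EFinM.
by rewrite mulKf// gt_eqF// pi_gt0.
Qed.

Lemma Rintegral_halfcircle_unit c :
  \int[leb]_(x in D) (x ^+ c * halfcircle s x) = semicircle_moment s c.
Proof.
rewrite /semicircle_moment Rintegral_mkcond [RHS]Rintegral_mkcond.
apply: eq_Rintegral => x _; rewrite !patchE !mem_setE.
case: ifPn => xD; case: ifPn => xs //.
  by rewrite halfcircle_out// mulr0.
by exfalso; move/negP: xD; apply; exact: subD.
Qed.

Hypothesis mass : nu D = (1 - t)%:E.

Let nufin : (nu setT < +oo)%E.
Proof. by rewrite mu_measure_setT mass ltry. Qed.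

Let nuDfin : (nu D < +oo)%E.
Proof. by rewrite mass ltry. Qed.

Let mom c := \int[nu]_(x in D) x ^+ c.

Let cX c : {within `[-1, 1], continuous (fun x : R => x ^+ c)}.
Proof. by apply: continuous_subspaceT; exact: exprn_continuous. Qed.

Let momE c : mom c = \int[leb]_(x in D) (x ^+ c * rho x).
Proof.
apply: (density_Rintegral (rho0 := mu_density_ge0 t)
  (mrho := measurable_mu_density t) nufin) => //.
exact: continuous_integrable.
Qed.

Let mXrho c : measurable_fun setT (fun x => x ^+ c * rho x).
Proof.
apply: measurable_funM; last exact: measurable_mu_density.
exact: measurable_funX.
Qed.

Let iXrho c : leb.-integrable D (EFin \o (fun x => x ^+ c * rho x)).
Proof.
have mD : measurable D by exact: measurable_itv.
apply: (@le_integrable _ _ _ leb D mD _ (EFin \o rho)).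
- by apply/measurable_EFinP; apply: measurable_funTS; exact: mXrho.
- move=> x; rewrite /= in_itv/= => x1; rewrite lee_fin normrM ler_piMl//.
  by rewrite normrX exprn_ile1// ler_norml.
- apply: (integrableS measurableT) => //.
  exact: (density_integrable (rho0 := mu_density_ge0 t)
    (mrho := measurable_mu_density t) nufin).
Qed.

(** The weight [1 - x ^ 2] cancels the denominator of the density, so consecutive
    moments of the same parity differ by a moment of the semicircle.  The total mass is
    an assumption because the case [t = 0], where the density is unbounded, gets it
    from elsewhere. *)
Lemma mu_measure_moments : limit_moments t mom.
Proof.
have pi0 : pi != 0 :> R by rewrite gt_eqF// pi_gt0.
apply: (limit_moments_of_recursion (W := fun c => pi^-1 * semicircle_moment s c)).
- rewrite /mom; under eq_Rintegral do rewrite expr0.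
  by rewrite Rintegral_cst// mul1r mass.
- rewrite momE; apply: (Rintegral_odd (mXrho 1) (iXrho 1)).
  by move=> x; rewrite rhoN !expr1 mulNr.
- move=> c; apply/eqP; rewrite eq_sym subr_eq addrC -subr_eq; apply/eqP.
  rewrite !momE -RintegralB// -Rintegral_halfcircle_unit -RintegralZl//; last first.
    apply: continuous_compact_integrable; first exact: segment_compact.
    apply: continuous_subspaceT => x.
    by apply: cvgM; [exact: exprn_continuous|exact: halfcircle_continuous].
  apply: eq_Rintegral => x _; rewrite mulrCA -rho_weight !exprS expr0; ring.
- by rewrite semicircle_moment0// sqr_s mulrA mulrA mulVf// mul1r.
- rewrite -Rintegral_halfcircle_unit Rintegral_odd ?mulr0//.
  + apply: measurable_funM => //; apply: continuous_measurable_fun.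
    exact: halfcircle_continuous.
  + apply: continuous_compact_integrable; first exact: segment_compact.
    apply: continuous_subspaceT => x.
    by apply: cvgM; [exact: exprn_continuous|exact: halfcircle_continuous].
  + by move=> x; rewrite halfcircleN !expr1 mulNr.
- by move=> c; rewrite mulrCA semicircle_momentSS// sqr_s mulrCA.
Qed.

End LimitMeasureMoments.

Lemma arcsine_densityE (R : realType) : @arcsine_density R = mu_density 0.
Proof.
apply/funext => x; rewrite /arcsine_density /mu_density !patchE !mem_setE.
rewrite expr0n/= subr0 sqrtr1 !in_itv/=.
have [x11|x11] := boolP (-1 < x < 1); last first.
  (* At the ends the denominator vanishes and the quotient is 0 by convention. *)
  case: ifPn => // /andP[x1 x1']; suff -> : 1 - x ^+ 2 = 0 by rewrite invr0 !mulr0.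
  move: x11; rewrite negb_and -!leNgt => /orP[xN|x1''].
    have -> : x = -1 by apply/eqP; rewrite eq_le xN.
    by rewrite sqrrN expr1n subrr.
  have -> : x = 1 by apply/eqP; rewrite eq_le x1'.
  by rewrite expr1n subrr.
case/andP: x11 => x1 x1'; rewrite !ltW//=.
have x0 : 0 < 1 - x ^+ 2 by nra.
rewrite invfM; congr (_ * _).
have q0 : 0 < Num.sqrt (1 - x ^+ 2) by rewrite sqrtr_gt0.
rewrite -[X in _ = _ / X](sqr_sqrtr (ltW x0)).
by field; rewrite gt_eqF.
Qed.

Lemma arcsine_measureE (R : realType) A : arcsine_measure R A = mu_measure (0 : R) A.
Proof. by rewrite /= /density_measure arcsine_densityE. Qed.

(** * Asymptotic zero distribution of the derivatives *)

Lemma size_real_zeros (R : realType) (p : {poly R[i]}) : p != 0 ->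
  size p = (size (real_zeros p)).+1.
Proof.
move=> p0; rewrite {1}(zerosE p) size_scale ?lead_coef_eq0// size_prod_XsubC.
by rewrite size_map.
Qed.

Theorem theorem1p1 (R : realType) (Q : nat -> {poly R[i]})
    (degQ : forall n, (0 < n)%N -> size (Q n) = n.+1)
    (zerosQ : forall n (z : R[i]), (0 < n)%N -> root (Q n) z ->
       exists2 x : R, x \in `[-1, 1] & z = x%:C%C)
    (cvgQ : weak_star_cvg (fun n => sigma Q n 0) (arcsine_measure R))
    (t : R) (t01 : t \in `[0, 1[)
    (k : nat -> nat) (kt : (k n)%:R / n%:R @[n --> \oo] --> t) :
  mu_measure t `<< lebesgue_measure /\
  weak_star_cvg (fun n => sigma Q n (k n)) (mu_measure t).
Proof.
split; first exact: density_dominated.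
have {}t01 : 0 <= t < 1 by move: t01; rewrite in_itv.
pose nd n j := normalized_derivative Q n j.
pose xs n j := real_zeros (nd n j).
have rQ n : (0 < n)%N -> roots_in_unit_interval (Q n) by move=> n0 z; exact: zerosQ.
have nd0 n j : (0 < n)%N -> (j <= n)%N -> nd n j != 0.
  move=> n0 jn; rewrite scaler_eq0 negb_or normalization_neq0//.
  exact: derivn_neq0 (degQ n n0) jn.
have nd1 n j : (0 < n)%N -> (j <= n)%N -> roots_in_unit_interval (nd n j).
  move=> n0 jn z; rewrite /nd /normalized_derivative rootZ ?normalization_neq0//.
  exact: (derivn_roots_in_unit_interval (degQ n n0) jn (rQ n n0)).
have size_xs n j : (0 < n)%N -> (j <= n)%N -> (size (xs n j) <= n)%N.
  move=> n0 jn; rewrite -ltnS -size_real_zeros ?nd0// (leq_trans (size_scale_leq _ _))//.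
  apply/leq_sizeP => i ni; rewrite coef_derivn nth_default ?mul0rn// degQ//.
  by rewrite (leq_trans ni)// leq_addl.
have sigmaE j n (f : R -> R) : (0 < n)%N -> (j <= n)%N -> {within `[-1, 1], continuous f} ->
    \int[sigma Q n j]_(x in `[-1, 1]) f x = (\sum_(x <- xs n j) f x) / n%:R.
  move=> n0 jn fc; rewrite mulrC.
  by apply: Rintegral_zero_counting => //; [exact: nd0|exact: nd1].
have cX c : {within `[-1, 1], continuous (fun x : R => x ^+ c)}.
  by apply: continuous_subspaceT; exact: exprn_continuous.
pose mom u c := \int[mu_measure (u : R)]_(x in `[-1, 1]) x ^+ c.
have cvg0 c : (\sum_(x <- xs n 0%N) x ^+ c) / n%:R @[n --> \oo] --> mom 0 c.
  have -> : mom 0 c = \int[arcsine_measure R]_(x in `[-1, 1]) x ^+ c.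
    rewrite /mom /Rintegral; congr fine; apply: eq_measure_integral => A mA _.
    by rewrite [RHS]arcsine_measureE.
  apply: cvg_trans (cvgQ _ (cX c)); apply: near_eq_cvg; near=> n.
  by rewrite sigmaE//; near: n; exists 1%N.
have xs0 n : (0 < n)%N -> size (xs n 0%N) = n.
  move=> n0; apply: succn_inj; rewrite -size_real_zeros ?nd0//.
  rewrite size_scale ?normalization_neq0//.
  by rewrite derivn0 degQ.
pose D : set (measurableTypeR R) := `[-1, 1]%classic.
(* The arcsine measure is a weak limit of probability measures, so it has mass 1. *)
have mass0 : mu_measure (0 : R) D = (1 - 0)%:E.
  have m1 : mom 0 0%N = 1.
    have /(cvg_lim (@Rhausdorff R)) <- := cvg0 0%N.
    apply: (cvg_lim (@Rhausdorff R)).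
    apply: cvg_near_cst; near=> n.
    have n0 : (0 < n)%N by near: n; exists 1%N.
    rewrite (eq_bigr (fun=> 1)); last by move=> x _; rewrite expr0.
    rewrite big_const_seq count_predT iter_addr_0 xs0// divff//.
    by rewrite pnatr_eq0 -lt0n.
  move: m1; rewrite /mom; under eq_Rintegral do rewrite expr0.
  rewrite Rintegral_cst// mul1r subr0.
  by case: (mu_measure 0 _) => [r /= ->//|/= /eqP|/= /eqP]; rewrite eq_sym oner_eq0.
have mass : mu_measure t D = (1 - t)%:E.
  have [t0|t0] := eqVneq t 0; first by rewrite t0.
  apply: mu_measure_mass => //; rewrite lt_def t0.
  by case/andP: t01.
have t1 : t < 1 by case/andP: t01.
have knear : \forall n \near \oo, (0 < n)%N /\ (k n < n)%N.
  near=> n; have n0 : (0 < n)%N by near: n; exists 1%N.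
  have : (k n)%:R / n%:R < 1 :> R.
    by near: n; exact: (cvgr_lt _ kt).
  by rewrite ltr_pdivrMr ?ltr0n// mul1r ltr_nat.
have cvgM c : (\sum_(x <- xs n (k n)) x ^+ c) / n%:R @[n --> \oo] --> mom t c.
  apply: (deriv_moments_cvg (P := fun n => \prod_(x <- xs n 0%N) ('X - x%:P)) t01 kt).
  - by move=> n n0; rewrite size_prod_XsubC xs0.
  - move=> n j n0 jn; apply: real_zeros_normalized_derivative; last exact: ltnW.
      exact: degQ.
    exact: rQ.
  - by apply: mu_measure_moments mass0; rewrite lexx ltr01.
  - exact: mu_measure_moments mass.
  - exact: cvg0.
move=> f fc; have := moments_weak_cvg (mu := mu_measure t) _ _ cvgM fc.
have -> : (mu_measure t D < +oo)%E by rewrite mass ltry.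
move=> /(_ isT) H; apply: cvg_trans (H _); last first.
  near=> n; have [n0 kn] : (0 < n)%N /\ (k n < n)%N by near: n.
  split; first by apply: size_xs => //; exact: ltnW.
  by apply: real_zeros_itv; [apply: nd0|apply: nd1] => //; exact: ltnW.
apply: near_eq_cvg; near=> n; have [n0 kn] : (0 < n)%N /\ (k n < n)%N by near: n.
by rewrite sigmaE// ltnW.
Unshelve. all: by end_near. Qed.
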